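(* There exist positive constants $c_0,c_1,C_0,C_1,C_2$ (depending only on the distribution of the entries of the sensing vectors) such that, under the sub-Gaussian sampling model with $m>c_1k\log(n^2/k)$, with probability at least $1-C_0\exp(-c_0m)$ the following holds simultaneously for all positive semidefinite $\Sigma\in\mathbb{R}^{n\times n}$, all $\epsilon_1\ge0$ and all $\eta\in\mathbb{R}^m$ with $\|\eta\|_1\le\epsilon_1$: letting $y=\mathcal A(\Sigma)+\eta$, any minimizer $\hat\Sigma$ of $$\min_M\ \|M\|_1\quad\text{subject to}\quad M\succeq0,\ \ \|y-\mathcal A(M)\|_1\le\epsilon_1$$ satisfies $$\|\hat\Sigma-\Sigma\|_{\mathrm F}\le C_1\frac{\|\Sigma-\Sigma_\Omega\|_1}{\sqrt k}+C_2\frac{\epsilon_1}{m}.$$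
   Context: Sub-Gaussian sampling model: $a_1,\dots,a_m\in\mathbb{R}^n$ are i.i.d. copies of $z=(z_1,\dots,z_n)^\top$ with i.i.d. sub-Gaussian entries, $\mathbb{E}[z_j]=0$, $\mathbb{E}[z_j^2]=1$, $\mu_4:=\mathbb{E}[z_j^4]>1$. $\mathcal A(M)=(a_i^\top Ma_i)_{i=1}^m$. For a matrix $M$, $\|M\|_1$ denotes the sum of absolute values of its entries. $\Sigma_\Omega$ denotes a best $k$-sparse approximation of $\Sigma$ (i.e. $\Sigma$ restricted to the $k$ entries of largest magnitude).
   Formalization: The formal theorem adds 1 ≤ k and 2k ≤ n²; without an upper bound on k the claim fails (for k = n² the condition on m is just m > 0, and exact recovery of all positive semidefinite Σ from a bounded number of measurements is impossible). *)

(* Defs.v *)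
From HB Require Import structures.
From mathcomp Require Import all_boot all_order all_algebra.
From mathcomp Require Import all_classical all_reals all_analysis.
Set Implicit Arguments. Unset Strict Implicit. Unset Printing Implicit Defensive.
Import Order.TTheory GRing.Theory Num.Theory.
Local Open Scope ring_scope.
Local Open Scope classical_set_scope.

Section Defs.
Variable R : realType.

Definition mnorm1 n (M : 'M[R]_n) : R := \sum_(i < n) \sum_(j < n) `|M i j|.

Definition frob n (M : 'M[R]_n) : R := Num.sqrt (\sum_(i < n) \sum_(j < n) (M i j) ^+ 2).

Definition vnorm1 m (v : 'cV[R]_m) : R := \sum_(i < m) `|v i 0|.

Definition psd n (M : 'M[R]_n) : Prop :=
  M^T = M /\ forall x : 'cV[R]_n, 0 <= (x^T *m M *m x) 0 0.

Definition Aop m n (a : 'I_m -> 'cV[R]_n) (M : 'M[R]_n) : 'cV[R]_m :=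
  \col_i (((a i)^T *m M *m a i) 0 0).

Definition is_topk n (k : nat) (Sig : 'M[R]_n) (S : {set 'I_n * 'I_n}) : Prop :=
  #|S| = k /\ forall p q, p \in S -> q \notin S -> `|Sig q.1 q.2| <= `|Sig p.1 p.2|.

Definition restrict_mx n (S : {set 'I_n * 'I_n}) (Sig : 'M[R]_n) : 'M[R]_n :=
  \matrix_(i, j) (if (i, j) \in S then Sig i j else 0).

Definition is_minimizer m n (a : 'I_m -> 'cV[R]_n) (y : 'cV[R]_m) (eps : R)
    (Mhat : 'M[R]_n) : Prop :=
  [/\ psd Mhat, vnorm1 (y - Aop a Mhat) <= eps &
      forall M, psd M -> vnorm1 (y - Aop a M) <= eps -> mnorm1 Mhat <= mnorm1 M].

Definition subgaussian (mu : probability R R) : Prop :=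
  exists K : R, 0 < K /\ forall t : R, 0 <= t ->
    (mu [set x : R | (t <= `|x|)%R] <= (2 * expR (- (t ^+ 2) / (K ^+ 2)))%:E)%E.

Definition mutually_independent d (T : measurableType d) (P : probability T R)
    (I : finType) (X : I -> T -> R) : Prop :=
  forall B : I -> set R, (forall i, measurable (B i)) ->
    fine (P (\bigcap_i (X i @^-1` B i))) = \prod_(i : I) fine (P (X i @^-1` B i)).

Definition has_law d (T : measurableType d) (P : probability T R)
    (X : T -> R) (mu : probability R R) : Prop :=
  measurable_fun setT X /\ forall B : set R, measurable B -> P (X @^-1` B) = mu B.

End Defs.

(* Main.v *)
(** Proof idea.  Write [h = m / 2] and replace the measurements by the differences
    [B_i(X) = a_i^T X a_i - a_(h+i)^T X a_(h+i)], [i < h]: their l1-norm is at most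
    that of [A(X)], and their mean vanishes, so the trace of [X] disappears.  Each
    [B_i(X)] is a centered quadratic chaos; it has exponential moments of scale
    [|X|_F], and for symmetric [X] its variance is at least a constant times
    [|X|_F^2] because the fourth moment exceeds 1, so that
    [E exp(-|B_i(X)|) <= exp(-c)] when [|X|_F] is of order 1.

    Minimality puts [H = Sighat - Sig] in the cone
    [|H|_1 <= 2 sqrt k |H|_F + 2 |Sig - Sig_S|_1], so either the bound is immediate
    or [|H|_1 <= 4 sqrt k |H|_F].  Normalise [|H|_F = 1] and round the entries of
    [H] towards 0 to multiples of [al] of order [1 / sqrt k].  The rounded matrix
    belongs to a finite net of size [exp(C k log(n^2 / k))] on which
    [sum |B_i|] is bounded below by a union bound.  The remainder has entries at
    most [al] and l1-norm at most [al N]; a linear form on such matrices is at most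
    [al] times the sum of the [N] largest absolute values of its coefficients, so
    [sum |B_i|] is controlled on it by the flat matrices with entries in
    [{0, al, -al}], whose Frobenius norm is small; a second union bound, over them and
    over the signs, applies.  Hence [sum |B_i(H)| >= c m |H|_F], while it is at
    most [|A(H)|_1 <= 2 eps1]. *)

Require Import Defs.
From HB Require Import structures.
From mathcomp Require Import all_boot all_order all_algebra.
From mathcomp Require Import all_classical all_reals all_analysis.
From mathcomp Require Import measurable_realfun ring lra.
Set Implicit Arguments. Unset Strict Implicit. Unset Printing Implicit Defensive.
Import Order.TTheory GRing.Theory Num.Theory.
Import numFieldNormedType.Exports.
Local Open Scope ring_scope.
Local Open Scope classical_set_scope.

(** * Independence and iterated integrals *)

Section independence_integral.
Context d d1 d2 (T : measurableType d) (U1 : measurableType d1)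
  (U2 : measurableType d2) (R : realType) (P : probability T R).

(** The joint law of [X] and [Y] agrees with the product of the marginal laws on rectangles, hence
    everywhere, and Tonelli applies. The target types are arbitrary so that a whole sigma-algebra
    can serve as a variable, with [X] the identity. *)
Lemma ge0_integral_indep_pair (X : T -> U1) (Y : T -> U2)
    (g : U1 * U2 -> \bar R) :
  measurable_fun setT X -> measurable_fun setT Y ->
  (forall A B, measurable A -> measurable B ->
    P (X @^-1` A `&` Y @^-1` B) = (P (X @^-1` A) * P (Y @^-1` B))%E) ->
  measurable_fun [set: U1 * U2] g -> (forall u, (0 <= g u)%E) ->
  (\int[P]_w g (X w, Y w) = \int[P]_w \int[P]_v g (X w, Y v))%E.
Proof.
move=> mX mY indXY mg g0.
pose X' : {mfun T >-> U1} := HB.pack X (isMeasurableFun.Build _ _ _ _ X mX).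
pose Y' : {mfun T >-> U2} := HB.pack Y (isMeasurableFun.Build _ _ _ _ Y mY).
pose XY := fun w => (X w, Y w).
have mXY : measurable_fun setT XY by exact: measurable_fun_pair.
pose XY' : {mfun T >-> (U1 * U2)%type} :=
  HB.pack XY (isMeasurableFun.Build _ _ _ _ XY mXY).
have -> : (\int[P]_w g (X w, Y w) = \int[distribution P XY']_u g u)%E.
  by rewrite ge0_integral_distribution.
have -> : (\int[distribution P XY']_u g u =
           \int[distribution P X' \x distribution P Y']_u g u)%E.
  apply: eq_measure_integral => A mA _; apply/esym.
  apply: product_measure_unique => // B C mB mC; exact: indXY.
rewrite fubini_tonelli1// -/X'.
rewrite (@ge0_integral_distribution _ _ _ _ _ P X').
- apply: eq_integral => w _ /=.
  rewrite /fubini_F (@ge0_integral_distribution _ _ _ _ _ P Y')//.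
  exact: measurable_fun_pair2.
- exact: measurable_fun_fubini_tonelli_F.
- by move=> y; apply: integral_ge0.
Qed.

End independence_integral.

(** * Sigma-algebras generated by groups of coordinates *)

Section rectangles.
Context d (T : measurableType d) (R : realType) (P : probability T R).
Context (I : finType) (Z : I -> T -> R).

(** A factor is kept for every index, trivial outside [A], because mutual independence is stated for
    all indices at once. *)
Definition rect (A : set I) : set (set T) :=
  [set F | exists2 B : I -> set R,
     (forall i, measurable (B i)) /\ (forall i, ~ A i -> B i = setT) &
     F = \bigcap_i (Z i @^-1` B i)].

(* [past A] is [T] equipped with the sigma-algebra generated by the [Z i],
   [i] in [A]. *)
Definition past (A : set I) := g_sigma_algebraType (rect A).

HB.instance Definition _ (A : set I) := Measurable.on (past A).

Hypothesis mZ : forall i, measurable_fun setT (Z i).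

Lemma rect_setI A : setI_closed (rect A).
Proof.
move=> F G [B [mB BT] ->] [C [mC CT] ->].
exists (fun i => B i `&` C i).
  split=> i; first exact: measurableI.
  by move=> nAi; rewrite BT// CT// setTI.
by rewrite -bigcapI; apply: eq_bigcapr.
Qed.

Lemma rectT A : rect A setT.
Proof.
exists (fun=> setT) => //.
by apply/seteqP; split.
Qed.

Lemma rect_measurable A : rect A `<=` @measurable _ T.
Proof.
move=> F [B [mB _] ->]; apply: fin_bigcap_measurable => // i _.
by rewrite -[X in measurable X]setTI; exact: mZ.
Qed.

Lemma past_measurable A (F : set T) :
  measurable (F : set (past A)) -> measurable F.
Proof.
move=> mF; apply: (@smallest_sub _ _ (rect A) measurable) F mF.
  exact: sigma_algebra_measurable.
exact: rect_measurable.
Qed.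

Lemma measurable_id_past A : measurable_fun setT (id : T -> past A).
Proof. by move=> _ F mF; rewrite setTI; exact: past_measurable mF. Qed.

Lemma measurable_fun_past A d' (U : measurableType d') (f : T -> U) :
  measurable_fun setT (f : past A -> U) -> measurable_fun setT f.
Proof.
by move=> mf _ B mB; rewrite setTI; apply: (@past_measurable A);
   rewrite -[X in measurable X]setTI; exact: mf.
Qed.

Lemma measurable_coord A i : A i -> measurable_fun setT (Z i : past A -> R).
Proof.
move=> Ai _ B mB; rewrite setTI; apply: sub_sigma_algebra.
exists (fun j => if j == i then B else setT).
  split=> j; first by case: ifP.
  by case: eqP => // ->.
apply/seteqP; split=> w /=.
  by move=> Bw j _ /=; case: eqP => // ->.
by move=> /(_ i Logic.I); rewrite /= eqxx.
Qed.

Hypothesis indZ : mutually_independent P Z.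

(** Two uniqueness arguments on pi-systems: first a rectangle [F0] is fixed and [G0] varies, then
    [G] is fixed and [F] varies. For two rectangles, disjointness of [A] and [B] makes one of the
    two factors trivial at every index. *)
Lemma past_indep A B (F G : set T) : A `&` B = set0 ->
  measurable (F : set (past A)) -> measurable (G : set (past B)) ->
  P (F `&` G) = (P F * P G)%E.
Proof.
move=> AB0.
have probE (E : set T) : measurable E -> P E = (fine (P E))%:E.
  by move=> mE; rewrite fineK// fin_num_measure.
have base F0 G0 : rect A F0 -> rect B G0 ->
    P (F0 `&` G0) = (P F0 * P G0)%E.
  move=> rF rG.
  have mF0 := rect_measurable rF; have mG0 := rect_measurable rG.
  rewrite (probE _ (measurableI _ _ mF0 mG0)) (probE _ mF0) (probE _ mG0) -EFinM.
  congr (_%:E); move: rF rG => [C [mC CT] ->] [D [mD DT] ->].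
  have -> : (\bigcap_i (Z i @^-1` C i)) `&` (\bigcap_i (Z i @^-1` D i)) =
      \bigcap_i (Z i @^-1` (C i `&` D i)) by rewrite -bigcapI.
  rewrite (indZ mC) (indZ mD) (indZ (fun i => measurableI _ _ (mC i) (mD i))).
  rewrite -big_split; apply: eq_bigr => i _ /=.
  have [Ai|nAi] := pselect (A i).
    have nBi : ~ B i by move=> Bi; have : (A `&` B) i by []; rewrite AB0.
    by rewrite (DT i nBi) setIT preimage_setT probability_setT /= mulr1.
  by rewrite (CT i nAi) setTI preimage_setT probability_setT /= mul1r.
have step1 F0 : rect A F0 -> forall G0, measurable (G0 : set (past B)) ->
    P (F0 `&` G0) = (P F0 * P G0)%E.
  move=> rF; have mF0 := rect_measurable rF.
  pose m1 := mrestr P mF0.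
  pose p : {nonneg R} := NngNum (fine_ge0 (measure_ge0 P F0)).
  pose m2 := mscale p P.
  move=> G0 mG0; rewrite setIC -[LHS]/(m1 G0).
  rewrite (probE _ mF0) -[RHS]/(m2 G0).
  apply: (@g_sigma_algebra_measure_unique _ R T (rect B)
    (@rect_measurable B) (fun=> setT) _ _ m1 m2 (@rect_setI B)) => //.
  - by move=> _; exact: rectT.
  - by rewrite bigcup_const.
  - move=> E rE; rewrite -[LHS]/(P (E `&` F0)) -[RHS]/((fine (P F0))%:E * P E)%E.
    by rewrite setIC base// -probE.
  - by move=> _; apply: fin_num_fun_lty; exact: fin_num_measure.
move=> mF mG; have mG' := past_measurable mG.
pose m1 := mrestr P mG'.
pose p : {nonneg R} := NngNum (fine_ge0 (measure_ge0 P G)).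
pose m2 := mscale p P.
rewrite -[LHS]/(m1 F) muleC (probE _ mG') -[RHS]/(m2 F).
apply: (@g_sigma_algebra_measure_unique _ R T (rect A)
  (@rect_measurable A) (fun=> setT) _ _ m1 m2 (@rect_setI A)) => //.
- by move=> _; exact: rectT.
- by rewrite bigcup_const.
- move=> E rE; rewrite -[LHS]/(P (E `&` G)) -[RHS]/((fine (P G))%:E * P E)%E.
  by rewrite step1// muleC -probE.
- by move=> _; apply: fin_num_fun_lty; exact: fin_num_measure.
Qed.

Lemma ge0_integral_past_prod A B (f g : T -> R) : A `&` B = set0 ->
  measurable_fun setT (f : past A -> R) ->
  measurable_fun setT (g : past B -> R) ->
  (forall w, 0 <= f w) -> (forall w, 0 <= g w) ->
  (\int[P]_w (f w * g w)%:E = \int[P]_w (f w)%:E * \int[P]_w (g w)%:E)%E.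
Proof.
move=> AB0 mf mg f0 g0.
pose h (u : past A * past B) := (f u.1 * g u.2)%:E.
rewrite -[LHS]/(\int[P]_w h (w, w))%E.
rewrite (@ge0_integral_indep_pair _ _ _ T (past A) (past B) R P id id h).
- rewrite -ge0_integralZr; last 4 first.
  + exact: measurableT.
  + by apply/measurable_EFinP; exact: measurable_fun_past mf.
  + by move=> w _; rewrite lee_fin.
  + by apply: integral_ge0 => w _; rewrite lee_fin.
  apply: eq_integral => w _; rewrite /h /=.
  under eq_integral do rewrite EFinM.
  rewrite ge0_integralZl//.
  + by apply/measurable_EFinP; exact: measurable_fun_past mg.
  + by move=> x _; rewrite lee_fin.
  + by rewrite lee_fin.
- exact: measurable_id_past.
- exact: measurable_id_past.
- by move=> F G mF mG; exact: (past_indep AB0).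
- apply/measurable_EFinP; apply: measurable_funM.
    exact: measurableT_comp mf measurable_fst.
  exact: measurableT_comp mg measurable_snd.
- by move=> u; rewrite /h lee_fin mulr_ge0.
Qed.

Variable mu : probability R R.
Hypothesis lawZ : forall i, has_law P (Z i) mu.

Lemma ge0_integral_coord i (f : R -> \bar R) : measurable_fun setT f ->
  (forall x, 0 <= f x)%E -> (\int[P]_w f (Z i w) = \int[mu]_x f x)%E.
Proof.
move=> mf f0; have [mZi lawi] := lawZ i.
pose Z' : {mfun T >-> R} := HB.pack (Z i) (isMeasurableFun.Build _ _ _ _ (Z i) mZi).
rewrite -[LHS]/(\int[P]_w (f \o Z') w)%E -ge0_integral_distribution//.
by apply: eq_measure_integral => B mB _; exact: lawi.
Qed.

(** Conditioning on the past: a coordinate outside [A] is integrated first, with everything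
    measurable for [past A] frozen. *)
Lemma ge0_integral_past_coord A i (g : past A * R -> \bar R) : ~ A i ->
  measurable_fun setT g -> (forall u, (0 <= g u)%E) ->
  (\int[P]_w g (w, Z i w) = \int[P]_w \int[mu]_x g (w, x))%E.
Proof.
move=> nAi mg g0.
rewrite (@ge0_integral_indep_pair _ _ _ T (past A) R R P id (Z i) g)//.
- apply: eq_integral => w _; rewrite (@ge0_integral_coord i (fun x => g (w, x)))//.
  exact: (@measurable_fun_pair2 _ _ _ (past A) _ _ _ w).
- exact: measurable_id_past.
- move=> F B mF mB; apply: (@past_indep A [set i]) => //.
    apply/seteqP; split => [j [Aj ji]|//]; apply: nAi.
    by rewrite -(ji : j = i).
  rewrite -[X in measurable X]setTI; apply: measurable_coord => //.
Qed.

End rectangles.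

(** * Sub-Gaussian laws *)

Section exponential_inequalities.
Context (R : realType).
Implicit Types u x t : R.

Lemma expR_le_taylor2 u : expR u <= 1 + u + u ^+ 2 * expR `|u|.
Proof.
have eB : expR u - 1 <= u * expR u.
  have := expR_ge1Dx (- u); rewrite expRN.
  have e0 := expR_gt0 u.
  move=> h; have : (1 - u) * expR u <= (expR u)^-1 * expR u.
    by rewrite ler_pM2r.
  by rewrite mulVf ?gt_eqF//; lra.
have [u0|u0] := leP 0 u.
  rewrite ger0_norm//.
  have : u * (expR u - 1) <= u * (u * expR u) by rewrite ler_wpM2l.
  by rewrite expr2; lra.
rewrite ltr0_norm//.
have h1 := expR_ge1Dx u.
have h2 : 1 <= expR (- u) by have := expR_ge1Dx (- u); lra.
have : - u * (1 - expR u) <= - u * - u by rewrite ler_wpM2l//; lra.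
have : - u * - u * 1 <= - u * - u * expR (- u).
  by rewrite ler_wpM2l// mulr_ge0//; lra.
by rewrite expr2; lra.
Qed.

(** Absorbs polynomial growth into an exponential of arbitrarily small rate. *)
Lemma sqr_le_expR (a y : R) : 0 < a -> 0 <= y ->
  (1 + y) ^+ 2 <= (1 + a^-1) ^+ 2 * expR (2 * a * y).
Proof.
move=> a0 y0; have ia0 : 0 < a^-1 by rewrite invr_gt0.
have aiV : a * a^-1 = 1 by rewrite divff// gt_eqF.
have h : 1 + y <= (1 + a^-1) * expR (a * y).
  apply: (@le_trans _ _ ((1 + a^-1) * (1 + a * y))); last first.
    by rewrite ler_wpM2l ?expR_ge1Dx//; lra.
  have -> : (1 + a^-1) * (1 + a * y) = 1 + y + a^-1 + a * y + y * (a * a^-1 - 1).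
    by ring.
  by rewrite aiV; have := mulr_ge0 (ltW a0) y0; lra.
have -> : expR (2 * a * y) = expR (a * y) ^+ 2.
  by rewrite -expRM_natl; congr expR; ring.
rewrite -exprMn ler_pXn2r ?nnegrE//; first by lra.
by apply: mulr_ge0; [lra|exact: expR_ge0].
Qed.

Lemma pow4_le_expR (l u : R) : 0 < l ->
  u ^+ 4 <= 24 / l ^+ 4 * (expR (l * u) + expR (- (l * u))).
Proof.
move=> l0.
have h (v : R) : 0 <= v -> v ^+ 4 / 24 <= expR v.
  by move=> v0; have := @expR_ge1Dxn R v 3 v0; rewrite (_ : 4`! = 24)%N//; lra.
have h2 (v : R) : v ^+ 4 / 24 <= expR v + expR (- v).
  have [v0|v0] := leP 0 v.
    by have := h v v0; have := expR_ge0 (- v); lra.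
  have := h (- v); rewrite oppr_ge0 (ltW v0) => /(_ isT).
  by rewrite (_ : (- v) ^+ 4 = v ^+ 4); [have := expR_ge0 v; lra|ring].
have -> : u ^+ 4 = 24 / l ^+ 4 * ((l * u) ^+ 4 / 24).
  by field; rewrite gt_eqF.
by rewrite ler_wpM2l// divr_ge0// exprn_ge0// ltW.
Qed.

(** Once integrated, this plays the role of the Paley-Zygmund inequality: a lower bound on the
    second moment and an upper bound on the fourth push the mean of [expR (- |u|)] below 1, with
    [eta] balancing the two. It follows from [exp(-v) <= 1 / (1 + v)], split at [v = 1]. *)
Lemma expRN_le_quartic (u eta : R) : 0 <= eta <= 1 ->
  expR (- `|u|) + (eta ^+ 2 * u ^+ 2) / 2 <= 1 + (eta ^+ 4 * u ^+ 4) / 2.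
Proof.
move=> /andP[e0 e1].
rewrite (_ : u ^+ 4 = (u ^+ 2) ^+ 2); last by rewrite -exprM.
rewrite -(real_normK (num_real u)); move: (normr_ge0 u); move: `|u| => v v0.
rewrite (_ : eta ^+ 4 * _ = ((eta * v) ^+ 2) ^+ 2); last by ring.
rewrite -exprMn; set t := eta * v.
have ev : expR (- v) * (1 + v) <= 1.
  rewrite expRN mulrC -/(_ / _) ler_pdivrMr ?expR_gt0// mul1r.
  exact: expR_ge1Dx.
have t0 : 0 <= t by rewrite mulr_ge0.
have tv : t <= v by rewrite /t -[leRHS]mul1r ler_wpM2r.
have e0' := expR_ge0 (- v).
have [v1|v1] := leP v 1.
  have : expR (- v) <= 1 - v / 2.
    rewrite -(@ler_pM2r _ (1 + v)); last by lra.
    by apply: le_trans ev _; nra.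
  have : t ^+ 2 <= t by rewrite expr2 -[leRHS]mul1r ler_wpM2r//; lra.
  by have := sqr_ge0 (t ^+ 2); lra.
have : expR (- v) <= 1 / 2.
  rewrite -(@ler_pM2r _ (1 + v)); last by lra.
  by apply: le_trans ev _; lra.
by have := sqr_ge0 (t ^+ 2 - 1 / 2); rewrite sqrrB; lra.
Qed.

End exponential_inequalities.

(** * Exponential square moments from Gaussian tails *)

Section tail_integral.
Context d (T : measurableType d) (R : realType) (P : probability T R).

Lemma measurable_set_ler (f g : T -> R) : measurable_fun setT f ->
  measurable_fun setT g -> measurable [set w | f w <= g w].
Proof.
move=> mf mg; rewrite -[X in measurable X]setTI.
exact: (measurable_fun_ler mf mg measurableT (Y := [set true])).
Qed.

(** Sum of the geometric series that dominates the layers in the next lemma; [th] is a quarter of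
    the tail rate. *)
Definition tail_const (K : R) : R :=
  let th := (4 * K ^+ 2)^-1 in 2 * expR (2 * th) * (1 - expR (- (2 * th)))^-1.

(** Cut according to the integer part [k] of [|f|]: the layer costs at most [exp(th (k+1)^2)] times
    the tail [2 exp(-4 th k^2)], which is below [2 exp(2 th) exp(-2 th k)] because
    [3 k^2 - 4 k + 1 >= 0] at integers. *)
Lemma ge0_integral_exp_sqr_le (f : T -> R) (K : R) : 0 < K ->
  measurable_fun setT f ->
  (forall t : R, 0 <= t -> (P [set w | (t <= `|f w|)%R] <=
     (2 * expR (- (t ^+ 2) / K ^+ 2))%:E)%E) ->
  (\int[P]_w (expR ((4 * K ^+ 2)^-1 * f w ^+ 2))%:E <= (tail_const K)%:E)%E.
Proof.
move=> K0 mf tail; rewrite /tail_const; set th := (4 * K ^+ 2)^-1.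
have th0 : 0 < th by rewrite invr_gt0 mulr_gt0// exprn_gt0.
have mA k : measurable [set w | (k%:R : R) <= `|f w|].
  by apply: measurable_set_ler => //; exact: measurableT_comp.
pose c k : R := expR (th * k.+1%:R ^+ 2).
pose g k w : \bar R := (c k * \1_([set w | k%:R <= `|f w|]) w)%:E.
have mg k : measurable_fun setT (g k).
  by apply/measurable_EFinP; apply: measurable_funM => //; exact: measurable_indic.
have g0 k w : (0 <= g k w)%E by rewrite lee_fin mulr_ge0 ?expR_ge0.
apply: (@le_trans _ _ (\int[P]_w \sum_(k <oo) g k w)%E).
  apply: ge0_le_integral => //.
  - apply/measurable_EFinP; apply: measurableT_comp => //.
    by apply: measurable_funM => //; apply: measurable_funX.
  - by apply: ge0_emeasurable_sum.
  - move=> w _; set k := Num.truncn `|f w|.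
    apply: (@le_trans _ _ (g k w)).
      rewrite lee_fin indicE mem_set ?mulr1 /=; last by rewrite truncn_le.
      rewrite ler_expR ler_wpM2l ?(ltW th0)// -(real_normK (num_real (f w))).
      by rewrite ler_pXn2r ?nnegrE ?ler0n// ltW// truncnS_gt.
    rewrite (@nneseriesD1 _ _ k)//.
    by rewrite leeDl// nneseries_ge0.
rewrite integral_nneseries//.
pose z := expR (- (2 * th)).
have z01 : 0 < z < 1 by rewrite expR_gt0 expR_lt1; lra.
apply: (@le_trans _ _ (\sum_(k <oo) (2 * expR (2 * th) * z ^+ k)%:E)%E).
  apply: lee_nneseries => [k _ _|k _]; first exact: integral_ge0.
  rewrite /g; under eq_integral do rewrite EFinM.
  rewrite ge0_integralZl//; last by rewrite lee_fin expR_ge0.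
    rewrite integral_indic// setIT.
    apply: (@le_trans _ _ ((c k)%:E * (2 * expR (- (k%:R ^+ 2) / K ^+ 2))%:E)%E).
      by rewrite lee_pmul2l ?lte_fin ?expR_gt0//; exact: tail.
    rewrite -EFinM lee_fin /c mulrCA -mulrA ler_pM2l// -expRM_natl -!expRD ler_expR.
    have -> : - k%:R ^+ 2 / K ^+ 2 = - (4 * th) * k%:R ^+ 2.
      by rewrite /th; field; rewrite gt_eqF.
    have k2 : (k%:R : R) <= k%:R ^+ 2.
      by rewrite -natrX ler_nat; case: (k) => // k'; rewrite expnS leq_pmulr.
    rewrite -natr1.
    have : 0 <= th * (k%:R - 1) ^+ 2 by rewrite mulr_ge0 ?sqr_ge0// ltW.
    have : th * k%:R <= th * k%:R ^+ 2 by rewrite ler_pM2l.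
    by rewrite !expr2; lra.
  by apply/measurable_EFinP; exact: measurable_indic.
apply: lime_le => //.
  by apply: is_cvg_nneseries => k _ _; rewrite lee_fin !mulr_ge0 ?exprn_ge0 ?expR_ge0.
near=> n.
rewrite sumEFin lee_fin -[leLHS]/(series (geometric (2 * expR (2 * th)) z) n).
apply: geometric_le_lim => //.
- by case/andP: z01.
- by rewrite gtr0_norm; case/andP: z01.
Unshelve. all: by end_near. Qed.

End tail_integral.

Lemma integral_prob_cst d (T : measurableType d) (R : realType)
  (P : probability T R) (a : R) : (\int[P]_x a%:E = a%:E)%E.
Proof. by rewrite integral_cst// [X in (_ * X)%E](@probability_setT _ _ _ P) mule1. Qed.

(** * Moments and moment generating function of one entry *)

Section law_moments.
Context (R : realType) (mu : probability R R) (th G : R).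
Hypothesis th0 : 0 < th.
Hypothesis expG : (\int[mu]_x (expR (th * x ^+ 2))%:E = G%:E)%E.
Hypothesis mean0 : (\int[mu]_x (x%:E) = 0)%E.
Hypothesis var1 : (\int[mu]_x ((x ^+ 2)%:E) = 1)%E.

Let mexp : measurable_fun setT (fun x : R => expR (th * x ^+ 2)).
Proof.
by apply: measurableT_comp => //; apply: measurable_funM => //; apply: measurable_funX.
Qed.

Lemma integrable_expsq : mu.-integrable setT (fun x => (expR (th * x ^+ 2))%:E).
Proof.
apply/integrableP; split; first exact/measurable_EFinP.
under eq_integral do rewrite gee0_abs ?lee_fin ?expR_ge0//.
by rewrite expG ltry.
Qed.

Lemma integrable_pow n : (n <= 4)%N -> mu.-integrable setT (fun x => (x ^+ n)%:E).
Proof.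
move=> n4.
apply: (@le_integrable _ _ _ mu setT measurableT _
  (fun x => ((1 + (th / 2)^-1) ^+ 2)%:E * (expR (th * x ^+ 2))%:E)%E).
- by apply/measurable_EFinP; apply: measurable_funX.
- move=> x _; rewrite -EFinM !abse_EFin lee_fin.
  rewrite [leRHS]ger0_norm; last first.
    by apply: mulr_ge0; [exact: sqr_ge0|exact: expR_ge0].
  apply: (@le_trans _ _ ((1 + x ^+ 2) ^+ 2)); last first.
    have := @sqr_le_expR R (th / 2) (x ^+ 2); rewrite divr_gt0// sqr_ge0.
    by rewrite (_ : 2 * (th / 2) = th); [exact|field].
  rewrite normrX -(real_normK (num_real x)).
  move: (normr_ge0 x) n4; move: `|x| => v v0.
  have vv := sqr_ge0 (v ^+ 2).
  case: n => [|[|[|[|[|n]]]]]// _; rewrite ?expr0 ?expr1; nra.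
- exact: (integrableZl measurableT _ integrable_expsq).
Qed.

Definition m3 : R := fine (\int[mu]_x ((x ^+ 3)%:E))%E.
Definition m4 : R := fine (\int[mu]_x ((x ^+ 4)%:E))%E.

(** The exact one-variable integrals below are brought to this form, with zero coefficients for
    absent terms, so that integrability and linearity are settled once. *)
Lemma integral_quartic_exp a0 a1 a2 a3 a4 b :
  (\int[mu]_x (a0 + a1 * x + a2 * x ^+ 2 + a3 * x ^+ 3 + a4 * x ^+ 4
               + b * expR (th * x ^+ 2))%:E =
   (a0 + a2 + a3 * m3 + a4 * m4 + b * G)%:E)%E.
Proof.
have i1 : mu.-integrable setT (fun x => x%:E) by exact: (@integrable_pow 1).
have i2 := @integrable_pow 2 isT; have i3 := @integrable_pow 3 isT.
have i4 := @integrable_pow 4 isT; have i5 := integrable_expsq.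
have I0 : mu.-integrable setT (fun=> a0%:E).
  exact: finite_measure_integrable_cst.
have IZ (c : R) (f : R -> R) : mu.-integrable setT (fun x => (f x)%:E) ->
    mu.-integrable setT (fun x => (c * f x)%:E).
  by move=> If; under eq_fun do rewrite EFinM; exact: integrableZl.
have ID (f g : R -> R) : mu.-integrable setT (fun x => (f x)%:E) ->
    mu.-integrable setT (fun x => (g x)%:E) ->
    mu.-integrable setT (fun x => (f x + g x)%:E).
  by move=> If Ig; under eq_fun do rewrite EFinD; exact: integrableD.
have eZ (c : R) (f : R -> R) : mu.-integrable setT (fun x => (f x)%:E) ->
    (\int[mu]_x (c * f x)%:E = c%:E * \int[mu]_x (f x)%:E)%E.
  by move=> If; under eq_integral do rewrite EFinM; rewrite integralZl.
have eD (f g : R -> R) : mu.-integrable setT (fun x => (f x)%:E) ->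
    mu.-integrable setT (fun x => (g x)%:E) ->
    (\int[mu]_x (f x + g x)%:E = \int[mu]_x (f x)%:E + \int[mu]_x (g x)%:E)%E.
  by move=> If Ig; under eq_integral do rewrite EFinD; rewrite integralD.
have J1 := IZ a1 _ i1; have J2 := IZ a2 _ i2; have J3 := IZ a3 _ i3.
have J4 := IZ a4 _ i4; have J5 := IZ b _ i5.
have K1 := ID _ _ I0 J1; have K2 := ID _ _ K1 J2; have K3 := ID _ _ K2 J3.
have K4 := ID _ _ K3 J4.
rewrite (eD _ _ K4 J5) (eD _ _ K3 J4) (eD _ _ K2 J3) (eD _ _ K1 J2) (eD _ _ I0 J1).
rewrite (eZ _ _ i1) (eZ _ _ i2) (eZ _ _ i3) (eZ _ _ i4) (eZ _ _ i5).
rewrite mean0 var1 expG (integral_prob_cst mu).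
have -> : (\int[mu]_x ((x ^+ 3)%:E) = m3%:E)%E.
  by rewrite /m3 fineK// integrable_fin_num.
have -> : (\int[mu]_x ((x ^+ 4)%:E) = m4%:E)%E.
  by rewrite /m4 fineK// integrable_fin_num.
by rewrite mule0 mule1 adde0 -!EFinM -!EFinD.
Qed.

(** Bessel's inequality for the projection of [x^2 - 1] on [x]. It keeps the term [m4 - 1 - m3^2] of
    the chaos variance nonnegative. *)
Lemma m3_sqr_le : m3 ^+ 2 <= m4 - 1.
Proof.
have : (0 <= \int[mu]_x (((x ^+ 2 - 1 - m3 * x) ^+ 2)%:E))%E.
  by apply: integral_ge0 => x _; rewrite lee_fin sqr_ge0.
under eq_integral => x _.
  rewrite (_ : _ ^+ 2 = 1 + 2 * m3 * x + (m3 ^+ 2 - 2) * x ^+ 2 + (- 2 * m3) * x ^+ 3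
    + 1 * x ^+ 4 + 0 * expR (th * x ^+ 2)); last by ring.
  over.
by rewrite integral_quartic_exp lee_fin; lra.
Qed.

Lemma expG_ge1 : 1 <= G.
Proof.
rewrite -lee_fin -expG -(integral_prob_cst mu 1).
apply: ge0_le_integral => //.
- exact/measurable_EFinP.
- move=> x _; rewrite lee_fin -expR0 ler_expR mulr_ge0// ?sqr_ge0//.
  exact: ltW.
Qed.

Let kap : R := 2 * (1 + (th / 4)^-1) ^+ 2 * expR (2 / th + th / 8).

Let kap0 : 0 <= kap.
Proof.
apply: mulr_ge0; last exact: expR_ge0.
by apply: mulr_ge0 => //; exact: sqr_ge0.
Qed.

Definition mgf_radius : R := th / 8.
Definition mgf_const : R :=
  2 * (1 + (th / 4)^-1) ^+ 2 * expR (2 / th + th / 8) * G + G + 2 / th + th.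

Lemma mgf_const_gt0 : 0 < mgf_const.
Proof.
rewrite /mgf_const; have := expG_ge1 => g1.
rewrite -/kap; have : 0 <= kap * G by rewrite mulr_ge0//; lra.
have : 0 < 2 / th by rewrite divr_gt0.
by have := th0; lra.
Qed.

(** [s] is unrestricted because it will be a random linear form in earlier coordinates; only [r]
    must be small. For [|s| <= 1] a second-order Taylor bound is integrated and its first-order
    terms vanish; for [|s| > 1] crude bounds suffice, since constants are absorbed by [s^2 > 1]. The
    constant [mgf_const] adds up the costs of both regimes. *)
Lemma mgf_le (s r : R) : `|r| <= mgf_radius ->
  (\int[mu]_x (expR (s * x + r * (x ^+ 2 - 1) - mgf_const * (s ^+ 2 + r ^+ 2)))%:E
    <= 1)%E.
Proof.
move=> rc; have th0' := th0.
have ith0 : 0 < th^-1 by rewrite invr_gt0.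
have G1 := expG_ge1.
have sr0 : 0 <= s ^+ 2 + r ^+ 2 by rewrite addr_ge0 ?sqr_ge0.
set V := mgf_const * _.
have mu_ : measurable_fun setT (fun x : R => (expR (s * x + r * (x ^+ 2 - 1)))%:E).
  apply/measurable_EFinP; apply: measurableT_comp => //.
  apply: measurable_funD; first exact: measurable_funM.
  by apply: measurable_funM => //; apply: measurable_funB => //; exact: measurable_funX.
suff : (\int[mu]_x (expR (s * x + r * (x ^+ 2 - 1)))%:E <= (expR V)%:E)%E.
  move=> h; under eq_integral do rewrite expRD mulrC EFinM.
  rewrite ge0_integralZl//.
  apply: (@le_trans _ _ ((expR (- V))%:E * (expR V)%:E)%E).
    by rewrite lee_pmul2l// lte_fin expR_gt0.
  by rewrite -EFinM -expRD addNr expR0.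
(* Weighted Young inequality that spends only an eighth of the available exponent [th]. *)
have AG x : `|s * x| <= s ^+ 2 * (2 / th) + th / 8 * x ^+ 2.
  have h : 0 <= (2 * th^-1) * (`|s| - th / 4 * `|x|) ^+ 2.
    by rewrite mulr_ge0 ?sqr_ge0//; lra.
  move: h; rewrite -(real_normK (num_real s)) -(real_normK (num_real x)) normrM.
  have -> : 2 / th * (`|s| - th / 4 * `|x|) ^+ 2 = `|s| ^+ 2 * (2 / th)
    - `|s| * `|x| + th / 8 * `|x| ^+ 2 by field; rewrite gt_eqF.
  by lra.
have RB x : `|r * (x ^+ 2 - 1)| <= th / 8 * (x ^+ 2 + 1).
  rewrite normrM ler_pM//; have := sqr_ge0 x => xx.
  by rewrite ler_norml; lra.
have [s1|s1] := leP (`|s|) 1.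
  apply: (@le_trans _ _ (\int[mu]_x ((1 - r) + s * x + r * x ^+ 2 + 0 * x ^+ 3 +
     0 * x ^+ 4 + (kap * (s ^+ 2 + r ^+ 2)) * expR (th * x ^+ 2))%:E)%E).
    apply: ge0_le_integral => //.
    - apply/measurable_EFinP.
      by repeat first [apply: measurable_funD | apply: measurable_funM
        | apply: measurable_funX | exact: mexp | exact: measurable_cst
        | exact: measurable_id].
    - move=> x _; rewrite lee_fin !mul0r !addr0.
      set u := s * x + r * (x ^+ 2 - 1).
      apply: (le_trans (expR_le_taylor2 u)).
      rewrite [leRHS](_ : _ = 1 + u + kap * (s ^+ 2 + r ^+ 2) * expR (th * x ^+ 2));
        last by rewrite /u; ring.
      rewrite lerD2l.
      have ss1 : s ^+ 2 <= 1.
        by rewrite -(real_normK (num_real s)) expr2 mulr_ile1.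
      have ule : `|u| <= 2 / th + th / 8 + (th / 4) * x ^+ 2.
        apply: (le_trans (ler_normD _ _)); have := AG x; have := RB x.
        have : s ^+ 2 * (2 / th) <= 1 * (2 / th) by rewrite ler_wpM2r//; lra.
        by lra.
      have u2 : u ^+ 2 <= 2 * (s ^+ 2 + r ^+ 2) * (1 + x ^+ 2) ^+ 2.
        have a1 : x ^+ 2 <= (1 + x ^+ 2) ^+ 2.
          by have := sqr_ge0 x; have := sqr_ge0 (x ^+ 2); lra.
        have a2 : (x ^+ 2 - 1) ^+ 2 <= (1 + x ^+ 2) ^+ 2.
          by have := sqr_ge0 x; lra.
        have := ler_wpM2l (sqr_ge0 s) a1; have := ler_wpM2l (sqr_ge0 r) a2.
        have : 0 <= (s * x - r * (x ^+ 2 - 1)) ^+ 2 by exact: sqr_ge0.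
        by rewrite /u; lra.
      have sq := @sqr_le_expR R (th / 4) (x ^+ 2) _ (sqr_ge0 x).
      have {}sq := sq (divr_gt0 th0 (ltr0n _ 4)).
      apply: (@le_trans _ _ (2 * (s ^+ 2 + r ^+ 2) *
        ((1 + (th / 4)^-1) ^+ 2 * expR (2 * (th / 4) * x ^+ 2)) *
        expR (2 / th + th / 8 + (th / 4) * x ^+ 2))).
        apply: ler_pM; rewrite ?sqr_ge0 ?expR_ge0// ?ler_expR//.
        apply: (le_trans u2); rewrite ler_wpM2l// mulr_ge0//.
      rewrite expRD.
      rewrite [leLHS](_ : _ = kap * (s ^+ 2 + r ^+ 2) *
        (expR (2 * (th / 4) * x ^+ 2) * expR (th / 4 * x ^+ 2))); last first.
        by rewrite /kap; ring.
      rewrite -expRD; apply: ler_wpM2l; first exact: mulr_ge0.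
      rewrite ler_expR.
      by have := mulr_ge0 (ltW th0) (sqr_ge0 x); lra.
  rewrite integral_quartic_exp lee_fin.
  apply: (@le_trans _ _ (1 + kap * G * (s ^+ 2 + r ^+ 2))); first by lra.
  apply: (le_trans (expR_ge1Dx _)); rewrite ler_expR ler_wpM2r//.
  by rewrite /mgf_const -/kap; lra.
apply: (@le_trans _ _ (\int[mu]_x ((expR (s ^+ 2 * (2 / th) + th / 8))%:E *
   (expR (th * x ^+ 2))%:E))%E).
  apply: ge0_le_integral => //.
  - by apply/measurable_EFinP; exact: measurable_funM.
  - move=> x _; rewrite -EFinM lee_fin -expRD ler_expR.
    have := AG x; have := RB x; have := ler_norm (s * x).
    have := ler_norm (r * (x ^+ 2 - 1)).
    by have := mulr_ge0 (ltW th0) (sqr_ge0 x); lra.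
rewrite ge0_integralZl//; last exact/measurable_EFinP.
rewrite expG -EFinM lee_fin.
apply: (@le_trans _ _ (expR (s ^+ 2 * (2 / th) + th / 8) * expR G)).
  rewrite ler_wpM2l ?expR_ge0//.
  by have := expR_ge1Dx G; lra.
rewrite -expRD ler_expR /V.
have s2 : 1 <= s ^+ 2 by rewrite -(real_normK (num_real s)) expr_ge1// ltW.
have e0 : 0 <= kap * G by rewrite mulr_ge0//; lra.
have h1 : G <= G * s ^+ 2 by rewrite ler_peMr//; lra.
have h2 : th <= th * s ^+ 2 by rewrite ler_peMr// ltW.
apply: (@le_trans _ _ (mgf_const * s ^+ 2)); last first.
  by rewrite ler_wpM2l ?(ltW mgf_const_gt0)// lerDl sqr_ge0.
rewrite /mgf_const -/kap; move: e0; set e := kap * G => e0.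
by have := mulr_ge0 e0 (sqr_ge0 s); lra.
Qed.

End law_moments.

(** * Quadratic chaos *)

Section markov.
Context d (T : measurableType d) (R : realType) (P : probability T R).

Lemma measure_le_integral (A : set T) (h : T -> R) : measurable A ->
  measurable_fun setT h -> (forall w, 0 <= h w) -> (forall w, A w -> 1 <= h w) ->
  (P A <= \int[P]_w (h w)%:E)%E.
Proof.
move=> mA mh h0 h1; rewrite -[X in (P X)%E]setIT -integral_indic//.
apply: ge0_le_integral => //.
- by apply/measurable_EFinP; exact: measurable_indic.
- exact/measurable_EFinP.
- move=> w _; rewrite lee_fin indicE.
  by have [/set_mem/h1|] := boolP (w \in A).
Qed.

End markov.

(** The weights may sum to less than 1; the missing mass is paid by the summand 1. The proof sums
    tangent-line inequalities at the weighted sum [U]. *)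
Lemma expR_jensen (R : realType) (n : nat) (p u : 'I_n -> R) :
  (forall i, 0 <= p i) -> \sum_i p i <= 1 ->
  expR (\sum_i p i * u i) <= 1 + \sum_i p i * expR (u i).
Proof.
move=> p0 p1; set U := \sum_i _.
have tangent i : expR U * (1 + (u i - U)) <= expR (u i).
  have -> : expR (u i) = expR U * expR (u i - U) by rewrite -expRD; congr expR; ring.
  by rewrite ler_wpM2l ?expR_ge0 ?expR_ge1Dx.
have : \sum_i p i * (expR U * (1 + (u i - U))) <= \sum_i p i * expR (u i).
  by apply: ler_sum => i _; rewrite ler_wpM2l.
have -> : \sum_i p i * (expR U * (1 + (u i - U))) =
    expR U * ((\sum_i p i) * (1 - U) + U).
  transitivity (\sum_i (expR U * (1 - U) * p i + expR U * (p i * u i))).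
    by apply: eq_bigr => i _; ring.
  by rewrite big_split/= -!mulr_sumr -/U; ring.
have : expR U * (1 - U) <= 1.
  have := expR_ge1Dx (- U); rewrite expRN -(@ler_pM2l _ (expR U)) ?expR_gt0//.
  by rewrite divff ?gt_eqF ?expR_gt0.
have q0 : 0 <= \sum_i p i by exact: sumr_ge0.
move: p1 q0; move: (\sum_i p i) => p' p1 q0 h1 h2.
have : (1 - p') * (expR U * (1 - U)) <= (1 - p') * 1 by rewrite ler_wpM2l//; lra.
by lra.
Qed.

(** * Martingale structure and moments of a quadratic chaos *)

Section chaos.
Context d (T : measurableType d) (R : realType) (P : probability T R).
Context (I : finType) (Z : I -> T -> R) (mu : probability R R) (th G : R).
Hypothesis th0 : 0 < th.
Hypothesis expG : (\int[mu]_x (expR (th * x ^+ 2))%:E = G%:E)%E.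
Hypothesis mean0 : (\int[mu]_x (x%:E) = 0)%E.
Hypothesis var1 : (\int[mu]_x ((x ^+ 2)%:E) = 1)%E.
Hypothesis lawZ : forall i, has_law P (Z i) mu.
Hypothesis indZ : mutually_independent P Z.

Let mZ i : measurable_fun setT (Z i). Proof. exact: (lawZ i).1. Qed.

Lemma past_mono (A B : set I) (f : T -> R) : A `<=` B ->
  measurable_fun setT (f : past Z A -> R) -> measurable_fun setT (f : past Z B -> R).
Proof.
move=> AB mf _ Y mY; have := mf measurableT Y mY; rewrite !setTI.
move=> mY'; apply: (@smallest_sub _ _ (rect Z A) <<s rect Z B >>) _ mY'.
  exact: smallest_sigma_algebra.
move=> F [C [mC CT] ->]; apply: sub_sigma_algebra.
by exists C => //; split=> // i nBi; apply: CT => /AB.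
Qed.

Variables (N : nat) (v : nat -> I).
Hypothesis v_inj : forall i j, (i < N)%N -> (j < N)%N -> v i = v j -> i = j.

(** [past Z (before n)] is the filtration revealing the coordinates in the order of [v]. *)
Definition before (n : nat) : set I := [set p | exists2 i, (i < n)%N & p = v i].

Let z i := Z (v i).

Let mzi i : measurable_fun setT (z i). Proof. exact: mZ. Qed.
#[local] Hint Resolve mzi : core.

Lemma before_mono m n : (m <= n)%N -> before m `<=` before n.
Proof. by move=> mn p [i im ->]; exists i => //; exact: leq_trans mn. Qed.

Lemma before_notin n : (n < N)%N -> ~ before n (v n).
Proof.
move=> nN [i iN /v_inj]; rewrite nN (ltn_trans iN nN) => /(_ isT isT) ni.
by move: iN; rewrite ni ltnn.
Qed.

Lemma measurable_before i n : (i < n)%N ->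
  measurable_fun setT (z i : past Z (before n) -> R).
Proof. by move=> iN; apply: measurable_coord; exists i. Qed.

Lemma measurable_before_lin (c : nat -> R) (e : R) n :
  measurable_fun setT ((fun w => e + \sum_(i < n) c i * z i w) : past Z (before n) -> R).
Proof.
apply: measurable_funD => //; apply: measurable_sum => i.
by apply: measurable_funM => //; exact: measurable_before.
Qed.

Let C := mgf_const th G.

Section supermartingale.
Variables (M : nat -> T -> R) (y : nat -> R).
Hypothesis mM : forall j, (j < N)%N ->
  measurable_fun setT (M j : past Z (before j) -> R).
Hypothesis yr : forall j, (j < N)%N -> `|y j| <= mgf_radius th.

Let inc j w := M j w * z j w + y j * (z j w ^+ 2 - 1).
Let comp j w := inc j w - C * (M j w ^+ 2 + y j ^+ 2).

Lemma measurable_inc_sum n : (n <= N)%N -> measurable_fun setT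
  ((fun w => \sum_(j < n) inc j w) : past Z (before n) -> R).
Proof.
move=> nN; apply: measurable_sum => j.
have mj := measurable_before (ltn_ord j).
have mMj : measurable_fun setT (M j : past Z (before n) -> R).
  apply: (past_mono (before_mono (ltnW (ltn_ord j)))).
  by apply: mM; exact: leq_trans (ltn_ord j) nN.
apply: measurable_funD; first exact: measurable_funM.
apply: measurable_funM => //; apply: measurable_funB => //.
exact: measurable_funX.
Qed.

Lemma measurable_comp_sum n : (n <= N)%N -> measurable_fun setT
  ((fun w => \sum_(j < n) comp j w) : past Z (before n) -> R).
Proof.
move=> nN; under eq_fun do rewrite sumrB.
apply: measurable_funB; first exact: measurable_inc_sum.
apply: measurable_sum => j.
apply: measurable_funM => //; apply: measurable_funD => //; apply: measurable_funX.
apply: (past_mono (before_mono (ltnW (ltn_ord j)))).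
by apply: mM; exact: leq_trans (ltn_ord j) nN.
Qed.

(** Conditionally on the first [n] coordinates, [M n] is a constant, so [mgf_le] bounds the mean of
    the last factor by 1; the subtracted term in [comp] is the compensator of the increment
    [inc]. *)
Lemma supermartingale_le1 n : (n <= N)%N ->
  (\int[P]_w (expR (\sum_(j < n) comp j w))%:E <= 1)%E.
Proof.
elim: n => [_|n IH nN].
  under eq_integral do rewrite big_ord0 expR0.
  by rewrite integral_prob_cst.
pose g (u : past Z (before n) * R) : \bar R :=
  (expR (\sum_(j < n) comp j u.1) * expR (M n u.1 * u.2 + y n * (u.2 ^+ 2 - 1)
     - C * (M n u.1 ^+ 2 + y n ^+ 2)))%:E.
have mS := measurable_comp_sum (ltnW nN).
have mMn := mM nN.
have m1 (f : T -> R) : measurable_fun setT (f : past Z (before n) -> R) ->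
    measurable_fun setT (fun u : past Z (before n) * R => f u.1).
  by move=> mf; exact: measurableT_comp mf measurable_fst.
have m2 : measurable_fun setT (fun u : past Z (before n) * R => u.2).
  exact: measurable_snd.
have mg : measurable_fun setT g.
  apply/measurable_EFinP; apply: measurable_funM.
    by apply: measurableT_comp => //; exact: (m1 _ mS).
  apply: measurableT_comp => //; apply: measurable_funB.
    apply: measurable_funD; first by apply: measurable_funM => //; exact: (m1 _ mMn).
    by apply: measurable_funM => //; apply: measurable_funB => //; exact: measurable_funX.
  apply: measurable_funM => //; apply: measurable_funD => //; apply: measurable_funX.
  exact: (m1 _ mMn).
have g0 u : (0 <= g u)%E by rewrite lee_fin mulr_ge0 ?expR_ge0.
have -> : (\int[P]_w (expR (\sum_(j < n.+1) comp j w))%:E =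
           \int[P]_w g (w, z n w))%E.
  by apply: eq_integral => w _; rewrite big_ord_recr /= expRD.
rewrite (ge0_integral_past_coord mZ indZ lawZ (before_notin nN))//.
apply: le_trans (IH (ltnW nN)).
apply: ge0_le_integral => //.
- by move=> w _; exact: integral_ge0.
- apply: (measurable_fun_past mZ (A := before n)).
  exact: (measurable_fun_fubini_tonelli_F (m2 := mu) g).
- apply/measurable_EFinP; apply: measurableT_comp => //.
  exact: (measurable_fun_past mZ mS).
- move=> w _; rewrite /g /=; under eq_integral do rewrite EFinM.
  rewrite ge0_integralZl//.
  + rewrite -[X in (_ <= X)%E]mule1 lee_pmul2l ?lte_fin ?expR_gt0//.
    exact: mgf_le (yr nN).
  + apply/measurable_EFinP; apply: measurableT_comp => //.
    apply: measurable_funB => //.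
    apply: measurable_funD; first exact: measurable_funM.
    by apply: measurable_funM => //; apply: measurable_funB => //; exact: measurable_funX.
Qed.

End supermartingale.

Lemma linear_mgf (x : nat -> R) (s : R) n : (n <= N)%N -> \sum_(i < n) x i ^+ 2 <= 1 ->
  (\int[P]_w (expR (s * \sum_(i < n) x i * z i w))%:E <= (expR (C * s ^+ 2))%:E)%E.
Proof.
move=> nN x1.
have C0 : 0 < C := mgf_const_gt0 th0 expG.
have h : (\int[P]_w (expR (\sum_(j < n) ((s * x j) * z j w + 0 * (z j w ^+ 2 - 1)
    - C * ((s * x j) ^+ 2 + 0 ^+ 2))))%:E <= 1)%E.
  apply: (@supermartingale_le1 (fun i _ => s * x i) (fun=> 0) _ _ n nN) => j _.
    exact: measurable_cst.
  by rewrite normr0 divr_ge0// ltW.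
have mz : measurable_fun setT (fun w => \sum_(i < n) x i * z i w).
  by apply: measurable_sum => i; apply: measurable_funM => //; exact: mzi.
have h2 : (\int[P]_w (expR (s * \sum_(i < n) x i * z i w - C * s ^+ 2))%:E <= 1)%E.
  apply: le_trans h; apply: ge0_le_integral => //.
  - apply/measurable_EFinP; apply: measurableT_comp => //.
    by apply: measurable_funB => //; apply: measurable_funM.
  - apply/measurable_EFinP; apply: measurableT_comp => //.
    apply: measurable_sum => i; apply: measurable_funB => //.
    apply: measurable_funD; first exact: measurable_funM.
    by apply: measurable_funM => //; apply: measurable_funB => //; exact: measurable_funX.
  - move=> w _; rewrite lee_fin ler_expR sumrB lerB//.
      rewrite mulr_sumr; apply: ler_sum => i _.
      by rewrite mul0r addr0 mulrA.
    under eq_bigr do rewrite expr0n addr0 exprMn.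
    rewrite -!mulr_sumr ler_wpM2l ?(ltW C0)//.
    by rewrite -[leRHS]mulr1 ler_wpM2l// sqr_ge0.
have -> : (\int[P]_w (expR (s * \sum_(i < n) x i * z i w))%:E =
   \int[P]_w ((expR (C * s ^+ 2))%:E *
     (expR (s * \sum_(i < n) x i * z i w - C * s ^+ 2))%:E))%E.
  apply: eq_integral => w _; rewrite -EFinM -expRD; congr (expR _)%:E; ring.
rewrite ge0_integralZl//.
  by rewrite -[X in (_ <= X)%E]mule1 lee_pmul2l// lte_fin expR_gt0.
apply/measurable_EFinP; apply: measurableT_comp => //.
by apply: measurable_funB => //; apply: measurable_funM.
Qed.

Lemma linear_exp_sqr (x : nat -> R) n : (n <= N)%N -> \sum_(i < n) x i ^+ 2 <= 1 ->
  (\int[P]_w (expR ((16 * C)^-1 * (\sum_(i < n) x i * z i w) ^+ 2))%:E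
     <= (tail_const (2 * Num.sqrt C))%:E)%E.
Proof.
move=> nN x1; have C0 : 0 < C := mgf_const_gt0 th0 expG.
have K2 : (2 * Num.sqrt C) ^+ 2 = 4 * C by rewrite exprMn sqr_sqrtr ?(ltW C0)//; ring.
have mz : measurable_fun setT (fun w => \sum_(i < n) x i * z i w).
  by apply: measurable_sum => i; apply: measurable_funM => //; exact: mzi.
have -> : (16 * C)^-1 = (4 * (2 * Num.sqrt C) ^+ 2)^-1.
  by rewrite K2; congr (_^-1); ring.
apply: (@ge0_integral_exp_sqr_le _ _ _ P (fun w => \sum_(i < n) x i * z i w)) => //.
  by rewrite mulr_gt0// sqrtr_gt0.
move=> t t0; rewrite K2; set L := fun w => \sum_(i < n) x i * z i w.
(* Minimiser of [C * s ^+ 2 - s * t]; the minimum is [- t ^+ 2 / (4 * C)]. *)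
pose s := t / (2 * C).
have s0 : 0 <= s by rewrite divr_ge0// mulr_ge0// ltW.
pose h w := expR (- (s * t)) * (expR (s * L w) + expR (- s * L w)).
have mE (r : R) : measurable_fun setT (fun w => expR (r * L w)).
  by apply: measurableT_comp => //; apply: measurable_funM.
apply: (@le_trans _ _ (\int[P]_w (h w)%:E)%E).
  apply: measure_le_integral.
  - by apply: measurable_set_ler => //; exact: measurableT_comp.
  - by apply: measurable_funM => //; apply: measurable_funD.
  - by move=> w; rewrite mulr_ge0 ?addr_ge0 ?expR_ge0.
  - move=> w /= tL; rewrite /h mulrDr -!expRD.
    have a1 := expR_ge0 (- (s * t) + s * L w).
    have a2 := expR_ge0 (- (s * t) + - s * L w).
    have [l0|l0] := leP 0 (L w).
      have : 1 <= expR (- (s * t) + s * L w); last by lra.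
      rewrite -expR0 ler_expR; move: tL; rewrite ger0_norm// => tL.
      by rewrite addrC subr_ge0; exact: ler_wpM2l.
    have : 1 <= expR (- (s * t) + - s * L w); last by lra.
    rewrite -expR0 ler_expR; move: tL; rewrite ltr0_norm// => tL.
    by rewrite addrC mulNr -mulrN subr_ge0; exact: ler_wpM2l.
rewrite /h; under eq_integral do rewrite EFinM EFinD.
rewrite ge0_integralZl//; last 2 first.
- by apply: emeasurable_funD; exact/measurable_EFinP.
- by move=> w _; rewrite adde_ge0.
rewrite ge0_integralD//; try exact/measurable_EFinP.
have := linear_mgf (- s) nN x1; rewrite sqrrN -/(L _) => l2.
have l1 := linear_mgf s nN x1.
apply: (@le_trans _ _ ((expR (- (s * t)))%:E *
  ((expR (C * s ^+ 2))%:E + (expR (C * s ^+ 2))%:E))%E).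
  by rewrite lee_pmul2l ?lte_fin ?expR_gt0//; exact: leeD.
rewrite -EFinD -EFinM lee_fin.
have -> : - t ^+ 2 / (4 * C) = - (s * t) + C * s ^+ 2.
  by rewrite /s; field; rewrite gt_eqF.
by rewrite expRD; lra.
Qed.

Section quadratic_chaos.
Variables (c : nat -> nat -> R) (y : nat -> R).

(** Triangular writing of a centred quadratic form: the factor of each new coordinate is linear in
    the earlier ones, so the partial sums form a martingale. *)
Definition chaos_coef j w := \sum_(i < j) c j i * z i w.

Definition chaos n w :=
  \sum_(j < n) (chaos_coef j w * z j w + y j * (z j w ^+ 2 - 1)).

Lemma measurable_chaos_coef j :
  measurable_fun setT (chaos_coef j : past Z (before j) -> R).
Proof.
have := @measurable_before_lin (c j) 0 j.
by under eq_fun do rewrite add0r.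
Qed.

Lemma measurable_chaos n : (n <= N)%N ->
  measurable_fun setT (chaos n : past Z (before n) -> R).
Proof.
move=> nN; apply: (@measurable_inc_sum chaos_coef y _ n nN) => j _.
exact: measurable_chaos_coef.
Qed.

(** The supermartingale is run at [2 * l] with [|y j| <= 2], whence the quarter of [mgf_radius]; the
    second bound gives [16 C l^2 <= (16 C)^-1], the exponent available in [linear_exp_sqr]. *)
Definition chaos_radius : R := Num.min (mgf_radius th / 4) (16 * C)^-1.

Definition chaos_const : R :=
  1 + expR (8 * C * chaos_radius ^+ 2) * (1 + tail_const (2 * Num.sqrt C)).

Lemma chaos_radius_gt0 : 0 < chaos_radius.
Proof.
have C0 : 0 < C := mgf_const_gt0 th0 expG.
by rewrite lt_min !divr_gt0 ?th0// invr_gt0 mulr_gt0.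
Qed.

Hypothesis c2 : \sum_(j < N) \sum_(i < j) c j i ^+ 2 <= 4.
Hypothesis y1 : \sum_(j < N) y j ^+ 2 <= 2.

Lemma tail_const_ge0 : 0 <= tail_const (2 * Num.sqrt C).
Proof.
rewrite /tail_const; set r := (_ * _)^-1.
have r0 : 0 < r.
  rewrite invr_gt0 mulr_gt0// exprn_gt0// mulr_gt0// sqrtr_gt0.
  exact: mgf_const_gt0 th0 expG.
apply: mulr_ge0; first by rewrite mulr_ge0 ?expR_ge0.
by rewrite invr_ge0 subr_ge0 -expR0 ler_expR oppr_le0 mulr_ge0// ltW.
Qed.

(* Jensen with weights proportional to [\sum_(i < j) c j i ^+ 2] reduces the sum of
   squares to squares of single normalised linear forms. *)
Lemma chaos_coef_exp_sqr (l : R) : `|l| <= (16 * C)^-1 ->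
  (\int[P]_w (expR (4 * C * l ^+ 2 * \sum_(j < N) chaos_coef j w ^+ 2))%:E
   <= (1 + tail_const (2 * Num.sqrt C))%:E)%E.
Proof.
move=> ll; have C0 : 0 < C := mgf_const_gt0 th0 expG.
pose wt (j : 'I_N) := \sum_(i < j) c j i ^+ 2.
have wt0 j : 0 <= wt j by apply: sumr_ge0 => i _; exact: sqr_ge0.
pose x j i := c j i / Num.sqrt (\sum_(i < j) c j i ^+ 2).
pose L (j : 'I_N) w := \sum_(i < j) x j i * z i w.
have x1 (j : 'I_N) : \sum_(i < j) x j i ^+ 2 <= 1.
  under eq_bigr do rewrite exprMn exprVn.
  rewrite -mulr_suml -/(wt j) sqr_sqrtr ?wt0//.
  have [->|wj] := eqVneq (wt j) 0; first by rewrite mul0r.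
  by rewrite divff.
have coefE : forall (j : 'I_N) w, chaos_coef j w ^+ 2 = wt j * L j w ^+ 2.
  (* A zero weight forces all [c j i] to vanish, so the default value of the division in [x] is
     harmless. *)
  move=> j w; have [wj|wj] := eqVneq (wt j) 0.
    rewrite wj mul0r /chaos_coef big1 ?expr0n// => i _.
    have : \sum_(i < j) c j i ^+ 2 == 0 by apply/eqP.
    rewrite psumr_eq0; last by move=> k _; exact: sqr_ge0.
    by move=> /allP /(_ i (mem_index_enum _)); rewrite sqrf_eq0 => /eqP ->; rewrite mul0r.
  rewrite -[in wt j](sqr_sqrtr (wt0 j)) -exprMn; congr (_ ^+ 2).
  rewrite mulr_sumr; apply: eq_bigr => i _; rewrite /x -/(wt j).
  by field; rewrite sqrtr_eq0 -ltNge lt_neqAle eq_sym wj wt0.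
pose p (j : 'I_N) := wt j / 4.
have p0 j : 0 <= p j by rewrite divr_ge0.
have p1 : \sum_j p j <= 1.
  by rewrite -mulr_suml ler_pdivrMr// mul1r.
have mL j : measurable_fun setT (L j).
  by apply: measurable_sum => i; apply: measurable_funM => //; exact: mzi.
have mu8 j : measurable_fun setT (fun w => expR (16 * C * l ^+ 2 * L j w ^+ 2)).
  by apply: measurableT_comp => //; apply: measurable_funM => //; exact: measurable_funX.
have l2 : 16 * C * l ^+ 2 <= (16 * C)^-1.
  have : `|l| ^+ 2 <= (16 * C)^-1 ^+ 2.
    by rewrite ler_pXn2r ?nnegrE ?invr_ge0 ?mulr_ge0// ltW.
  rewrite real_normK ?num_real// => l2.
  apply: (@le_trans _ _ (16 * C * (16 * C)^-1 ^+ 2)).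
    by rewrite ler_wpM2l// mulr_ge0// ltW.
  by rewrite expr2 mulrA divff ?mul1r// gt_eqF// mulr_gt0.
apply: (@le_trans _ _
  (\int[P]_w (1 + \sum_j p j * expR (16 * C * l ^+ 2 * L j w ^+ 2))%:E)%E).
  apply: ge0_le_integral => //.
  - apply/measurable_EFinP; apply: measurableT_comp => //; apply: measurable_funM => //.
    apply: measurable_sum => j; apply: measurable_funX.
    exact: (measurable_fun_past mZ (@measurable_chaos_coef j)).
  - apply/measurable_EFinP; apply: measurable_funD => //; apply: measurable_sum => j.
    exact: measurable_funM.
  - move=> w _; rewrite lee_fin; apply: le_trans (expR_jensen _ p0 p1).
    rewrite ler_expR mulr_sumr; apply: ler_sum => j _; rewrite coefE /p.
    by rewrite [leLHS](_ : _ = wt j / 4 * (16 * C * l ^+ 2 * L j w ^+ 2))//; field.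
under eq_integral do rewrite EFinD -sumEFin.
rewrite ge0_integralD//; last 2 first.
- by move=> w _; apply: sume_ge0 => j _; rewrite lee_fin mulr_ge0 ?expR_ge0.
- by apply: emeasurable_sum => j; apply/measurable_EFinP; exact: measurable_funM.
rewrite integral_prob_cst EFinD leeD2l// ge0_integral_sum//; last 2 first.
- by move=> j; apply/measurable_EFinP; exact: measurable_funM.
- by move=> j w _; rewrite lee_fin mulr_ge0 ?expR_ge0.
apply: (@le_trans _ _ (\sum_j (p j * tail_const (2 * Num.sqrt C))%:E)%E).
  apply: lee_sum => j _; under eq_integral do rewrite EFinM.
  rewrite ge0_integralZl//; last 2 first.
  - exact/measurable_EFinP.
  - by rewrite lee_fin.
  rewrite [X in (_ <= X)%E]EFinM; apply: lee_pmul => //; [by rewrite lee_fin|exact: integral_ge0|].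
  apply: le_trans (linear_exp_sqr (ltnW (ltn_ord j)) (x1 j)).
  apply: ge0_le_integral => //.
  - exact/measurable_EFinP.
  - apply/measurable_EFinP; apply: measurableT_comp => //; apply: measurable_funM => //.
    by apply: measurable_funX; exact: (mL j).
  - by move=> w _; rewrite lee_fin ler_expR ler_wpM2r// sqr_ge0.
by rewrite sumEFin lee_fin -mulr_suml -[leRHS]mul1r ler_wpM2r ?tail_const_ge0.
Qed.

(* No decoupling is needed: [exp(l Q) <= exp(2 l Q - V) + exp V], where [V] is the
   compensator of the exponential supermartingale of [2 l Q]. *)
Lemma chaos_mgf (l : R) : `|l| <= chaos_radius ->
  (\int[P]_w (expR (l * chaos N w))%:E <= chaos_const%:E)%E.
Proof.
move=> ll; have C0 : 0 < C := mgf_const_gt0 th0 expG.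
have ll1 : `|l| <= mgf_radius th / 4.
  by apply: (le_trans ll); rewrite /chaos_radius ge_min lexx.
have ll2 : `|l| <= (16 * C)^-1.
  by apply: (le_trans ll); rewrite /chaos_radius ge_min lexx orbT.
have y1j j : (j < N)%N -> `|y j| <= 2.
  move=> jN; rewrite -(@ler_pXn2r _ 2) ?nnegrE// real_normK ?num_real//.
  apply: (@le_trans _ _ 2); last by rewrite expr2; lra.
  apply: le_trans y1; rewrite (bigD1 (Ordinal jN))//= lerDl.
  by apply: sumr_ge0 => i _; exact: sqr_ge0.
pose V w := C * \sum_(j < N) ((2 * l * chaos_coef j w) ^+ 2 + (2 * l * y j) ^+ 2).
have mM j : measurable_fun setT (fun w => chaos_coef j w).
  exact: (measurable_fun_past mZ (@measurable_chaos_coef j)).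
have mQ : measurable_fun setT (chaos N).
  exact: (measurable_fun_past mZ (measurable_chaos (leqnn N))).
have mV : measurable_fun setT V.
  apply: measurable_funM => //; apply: measurable_sum => j; apply: measurable_funD => //.
  by apply: measurable_funX; apply: measurable_funM.
have h1 : (\int[P]_w (expR (2 * l * chaos N w - V w))%:E <= 1)%E.
  have := @supermartingale_le1 (fun j w => 2 * l * chaos_coef j w)
    (fun j => 2 * l * y j) _ _ N (leqnn N).
  have h j : (j < N)%N -> measurable_fun setT
     ((fun w => 2 * l * chaos_coef j w) : past Z (before j) -> R).
    by move=> jN; apply: measurable_funM => //; exact: measurable_chaos_coef.
  have h' j : (j < N)%N -> `|2 * l * y j| <= mgf_radius th.
    move=> jN; rewrite !normrM ger0_norm//.
    have := ler_pM (normr_ge0 l) (normr_ge0 (y j)) ll1 (y1j j jN); lra.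
  move=> /(_ h h'); apply: le_trans; rewrite le_eqVlt; apply/orP; left; apply/eqP.
  apply: eq_integral => w _; congr (expR _)%:E.
  by rewrite sumrB /V /chaos !mulr_sumr; congr (_ - _); apply: eq_bigr => j _; ring.
(* The part of [V] coming from [y] is at most [8 C l^2]; the random part is handled by
   [chaos_coef_exp_sqr]. *)
have h2 : (\int[P]_w (expR (V w))%:E <=
   (expR (8 * C * chaos_radius ^+ 2) * (1 + tail_const (2 * Num.sqrt C)))%:E)%E.
  apply: (@le_trans _ _ (\int[P]_w ((expR (8 * C * chaos_radius ^+ 2))%:E *
      (expR (4 * C * l ^+ 2 * \sum_(j < N) chaos_coef j w ^+ 2))%:E))%E).
    apply: ge0_le_integral => //.
    - by apply/measurable_EFinP; apply: measurableT_comp.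
    - apply/measurable_EFinP; apply: measurable_funM => //.
      apply: measurableT_comp => //; apply: measurable_funM => //.
      by apply: measurable_sum => j; apply: measurable_funX.
    - move=> w _; rewrite -EFinM lee_fin -expRD ler_expR /V big_split/= mulrDr addrC.
      under eq_bigr do rewrite exprMn.
      under [X in _ + C * X]eq_bigr do rewrite exprMn.
      rewrite -!mulr_sumr; apply: lerD; last by rewrite le_eqVlt; apply/orP; left; apply/eqP; ring.
      have l2 : l ^+ 2 <= chaos_radius ^+ 2.
        rewrite -(real_normK (num_real l)) ler_pXn2r ?nnegrE//.
        exact: ltW chaos_radius_gt0.
      apply: (@le_trans _ _ (C * ((2 * l) ^+ 2 * 2))).
        by rewrite !ler_wpM2l ?sqr_ge0// ltW.
      have := ler_wpM2l (ltW C0) l2; lra.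
  rewrite ge0_integralZl//.
    rewrite EFinM lee_pmul2l ?lte_fin ?expR_gt0//; exact: chaos_coef_exp_sqr.
  apply/measurable_EFinP; apply: measurableT_comp => //; apply: measurable_funM => //.
  by apply: measurable_sum => j; apply: measurable_funX.
apply: (@le_trans _ _ (\int[P]_w ((expR (2 * l * chaos N w - V w))%:E + (expR (V w))%:E))%E).
  apply: ge0_le_integral => //.
  - by apply/measurable_EFinP; apply: measurableT_comp => //; apply: measurable_funM.
  - apply: emeasurable_funD; apply/measurable_EFinP; apply: measurableT_comp => //.
    by apply: measurable_funB => //; apply: measurable_funM.
  - move=> w _; rewrite -EFinD lee_fin.
    have -> : 2 * l * chaos N w - V w = (l * chaos N w) + (l * chaos N w - V w) by ring.
    set a := l * chaos N w.
    have [aV|aV] := leP a (V w).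
      apply: (@le_trans _ _ (expR (V w))); first by rewrite ler_expR.
      by rewrite lerDr expR_ge0.
    apply: (@le_trans _ _ (expR (a + (a - V w)))); last by rewrite lerDl expR_ge0.
    by rewrite ler_expR; lra.
rewrite ge0_integralD//.
- by rewrite /chaos_const EFinD; exact: leeD.
- apply/measurable_EFinP; apply: measurableT_comp => //.
  by apply: measurable_funB => //; apply: measurable_funM.
- by apply/measurable_EFinP; apply: measurableT_comp.
Qed.

End quadratic_chaos.

(** The offset [e] will carry the third-moment term [m3 mu * y n] of the chaos variance. *)
Lemma linear_second_moment (x : nat -> R) (e : R) n : (n <= N)%N ->
  (\int[P]_w ((e + \sum_(i < n) x i * z i w) ^+ 2)%:E =
   (e ^+ 2 + \sum_(i < n) x i ^+ 2)%:E)%E.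
Proof.
elim: n => [_|n IH nN].
  by under eq_integral do rewrite big_ord0 addr0; rewrite integral_prob_cst big_ord0 addr0.
pose L w := e + \sum_(i < n) x i * z i w.
pose g (u : past Z (before n) * R) : \bar R := ((L u.1 + x n * u.2) ^+ 2)%:E.
have mL : measurable_fun setT (L : past Z (before n) -> R).
  exact: measurable_before_lin.
have mg : measurable_fun setT g.
  apply/measurable_EFinP; apply: measurable_funX; apply: measurable_funD.
    exact: (measurableT_comp mL measurable_fst).
  by apply: measurable_funM => //; exact: measurable_snd.
have -> : (\int[P]_w ((e + \sum_(i < n.+1) x i * z i w) ^+ 2)%:E =
           \int[P]_w g (w, z n w))%E.
  by apply: eq_integral => w _; rewrite big_ord_recr /= addrA.
rewrite (ge0_integral_past_coord mZ indZ lawZ (before_notin nN))//; last first.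
  by move=> u; rewrite lee_fin sqr_ge0.
under eq_integral => w _.
  rewrite /g/=.
  under eq_integral => t _.
    rewrite (_ : _ ^+ 2 = L w ^+ 2 + 2 * L w * x n * t + x n ^+ 2 * t ^+ 2 + 0 * t ^+ 3
      + 0 * t ^+ 4 + 0 * expR (th * t ^+ 2)); last by ring.
    over.
  rewrite (integral_quartic_exp th0 expG mean0 var1) !mul0r !addr0 EFinD.
  over.
rewrite ge0_integralD//.
- rewrite (IH (ltnW nN)) integral_prob_cst big_ord_recr/= -EFinD; congr (_%:E); ring.
- by move=> w _; rewrite lee_fin sqr_ge0.
- apply/measurable_EFinP; apply: measurable_funX; exact: (measurable_fun_past mZ mL).
- by move=> w _; rewrite lee_fin sqr_ge0.
Qed.

(** Each increment has conditional mean zero, so squares add up along the filtration; the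
    third-moment cross terms have mean zero in the end. *)
Lemma chaos_second_moment c y n : (n <= N)%N ->
  (\int[P]_w (chaos c y n w ^+ 2)%:E =
   (\sum_(j < n) (\sum_(i < j) c j i ^+ 2 + (m4 mu - 1) * y j ^+ 2))%:E)%E.
Proof.
elim: n => [_|n IH nN].
  under eq_integral do rewrite /chaos big_ord0 expr0n.
  by rewrite integral_prob_cst big_ord0.
pose Q := chaos c y n; pose M := chaos_coef c n.
pose g (u : past Z (before n) * R) : \bar R :=
  ((Q u.1 + (M u.1 * u.2 + y n * (u.2 ^+ 2 - 1))) ^+ 2)%:E.
have mQ : measurable_fun setT (Q : past Z (before n) -> R).
  exact: measurable_chaos (ltnW nN).
have mM : measurable_fun setT (M : past Z (before n) -> R).
  exact: measurable_chaos_coef.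
have m2 : measurable_fun setT (fun u : past Z (before n) * R => u.2).
  exact: measurable_snd.
have mg : measurable_fun setT g.
  apply/measurable_EFinP; apply: measurable_funX; apply: measurable_funD.
    exact: (measurableT_comp mQ measurable_fst).
  apply: measurable_funD.
    apply: measurable_funM => //.
    exact: (measurableT_comp mM measurable_fst).
  by apply: measurable_funM => //; apply: measurable_funB => //; apply: measurable_funX.
have -> : (\int[P]_w (chaos c y n.+1 w ^+ 2)%:E = \int[P]_w g (w, z n w))%E.
  by apply: eq_integral => w _; rewrite /chaos big_ord_recr.
rewrite (ge0_integral_past_coord mZ indZ lawZ (before_notin nN))//; last first.
  by move=> u; rewrite lee_fin sqr_ge0.
have m34 := m3_sqr_le th0 expG mean0 var1.
have k0 : 0 <= (m4 mu - 1 - m3 mu ^+ 2) * y n ^+ 2.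
  by rewrite mulr_ge0 ?sqr_ge0// subr_ge0.
have m1' := measurable_fun_past mZ mQ; have m2' := measurable_fun_past mZ mM.
under eq_integral => w _.
  rewrite /g/=.
  under eq_integral => t _.
    rewrite (_ : _ ^+ 2 = (Q w - y n) ^+ 2 + 2 * (Q w - y n) * M w * t
      + (M w ^+ 2 + 2 * (Q w - y n) * y n) * t ^+ 2 + 2 * M w * y n * t ^+ 3
      + y n ^+ 2 * t ^+ 4 + 0 * expR (th * t ^+ 2)); last by ring.
    over.
  rewrite (integral_quartic_exp th0 expG mean0 var1).
  (* Completing the square hides the signed cross term in nonnegative pieces, whose integrals add
     without an integrability check; [m3_sqr_le] gives the sign of the last one. *)
  rewrite [X in X%:E](_ : _ = Q w ^+ 2 + ((m3 mu * y n + M w) ^+ 2 +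
    (m4 mu - 1 - m3 mu ^+ 2) * y n ^+ 2)); last by ring.
  rewrite 2!EFinD.
  over.
rewrite ge0_integralD//; last 4 first.
- by move=> w _; rewrite lee_fin sqr_ge0.
- by apply/measurable_EFinP; apply: measurable_funX.
- by move=> w _; rewrite -EFinD lee_fin addr_ge0// sqr_ge0.
- apply: emeasurable_funD => //; apply/measurable_EFinP; apply: measurable_funX.
  exact: measurable_funD.
rewrite ge0_integralD//; last 2 first.
- by move=> w _; rewrite lee_fin sqr_ge0.
- apply/measurable_EFinP; apply: measurable_funX; exact: measurable_funD.
rewrite IH ?(ltnW nN)// integral_prob_cst (linear_second_moment _ _ (ltnW nN)).
by rewrite -!EFinD big_ord_recr/=; congr (_%:E); ring.
Qed.

End chaos.

(** * Tail bounds for sums of chaoses over disjoint blocks of coordinates *)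

Section blocks.
Context d (T : measurableType d) (R : realType) (P : probability T R).
Context (I : finType) (Z : I -> T -> R) (mu : probability R R) (th G : R).
Hypothesis th0 : 0 < th.
Hypothesis expG : (\int[mu]_x (expR (th * x ^+ 2))%:E = G%:E)%E.
Hypothesis mean0 : (\int[mu]_x (x%:E) = 0)%E.
Hypothesis var1 : (\int[mu]_x ((x ^+ 2)%:E) = 1)%E.
Hypothesis lawZ : forall i, has_law P (Z i) mu.
Hypothesis indZ : mutually_independent P Z.

Let mZ i : measurable_fun setT (Z i). Proof. exact: (lawZ i).1. Qed.

(** The union of the earlier blocks is disjoint from the next one, so the last factor splits off by
    independence. *)
Lemma integral_prod_past_le (blk : nat -> set I) (f : nat -> T -> R) (K : R) m :
  (forall i j, (i < j)%N -> (j < m)%N -> blk i `&` blk j = set0) ->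
  (forall i, (i < m)%N -> measurable_fun setT (f i : past Z (blk i) -> R)) ->
  (forall i w, 0 <= f i w) -> 0 <= K ->
  (forall i, (i < m)%N -> (\int[P]_w (f i w)%:E <= K%:E)%E) ->
  (\int[P]_w (\prod_(i < m) f i w)%:E <= (K ^+ m)%:E)%E.
Proof.
move=> disj mf f0 K0 fK.
suff : forall k, (k <= m)%N -> (\int[P]_w (\prod_(i < k) f i w)%:E <= (K ^+ k)%:E)%E.
  exact.
elim=> [_|k IH km].
  by under eq_integral do rewrite big_ord0; rewrite integral_prob_cst expr0.
pose A := \bigcup_(i in [set i | (i < k)%N]) blk i.
under eq_integral do rewrite big_ord_recr/=.
rewrite (ge0_integral_past_prod mZ indZ (A := A) (B := blk k)).
- rewrite exprSr EFinM; apply: lee_pmul.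
  + by apply: integral_ge0 => w _; rewrite lee_fin prodr_ge0.
  + by apply: integral_ge0 => w _; rewrite lee_fin.
  + exact: IH (ltnW km).
  + exact: fK.
- apply/seteqP; split => // p [[i ik pi] pk].
  by have := disj i k ik km; move/seteqP => [+ _]; apply; split.
- apply: measurable_prod => i _; apply: (past_mono (A := blk i)).
    by move=> p pi; exists (i : nat) => //=.
  by apply: mf; exact: ltn_trans (ltn_ord i) km.
- exact: mf.
- by move=> w; exact: prodr_ge0.
- exact: f0.
Qed.

Variables (m N : nat) (v : nat -> nat -> I).
Hypothesis v_inj : forall i p j q, (i < m)%N -> (p < N)%N -> (j < m)%N -> (q < N)%N ->
  v i p = v j q -> i = j /\ p = q.

Let vi_inj i : (i < m)%N ->
  forall p q, (p < N)%N -> (q < N)%N -> v i p = v i q -> p = q.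
Proof. by move=> im p q pN qN vpq; have [] := v_inj im pN im qN vpq. Qed.

Let blk i := before (v i) N.

Let blk_disj i j : (i < j)%N -> (j < m)%N -> blk i `&` blk j = set0.
Proof.
move=> ij jm; apply/seteqP; split => // x [[p pN ->] [q qN /v_inj]].
rewrite pN qN jm (ltn_trans ij jm) => /(_ isT isT isT isT)[ijE _].
by move: ij; rewrite ijE ltnn.
Qed.

Variables (c : nat -> nat -> R) (y : nat -> R).
Hypothesis c2 : \sum_(j < N) \sum_(i < j) c j i ^+ 2 <= 4.
Hypothesis y1 : \sum_(j < N) y j ^+ 2 <= 2.

Let B i := chaos Z (v i) c y N.
Let r := chaos_radius th G.
Let K := chaos_const th G.

Lemma measurable_block i : (i < m)%N -> measurable_fun setT (B i : past Z (blk i) -> R).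
Proof. by move=> im; exact: measurable_chaos. Qed.

Lemma block_mgf i (l : R) : (i < m)%N -> `|l| <= r ->
  (\int[P]_w (expR (l * B i w))%:E <= K%:E)%E.
Proof.
move=> im lr; exact: (chaos_mgf th0 expG mean0 var1 lawZ indZ (vi_inj im) c2 y1 lr).
Qed.

Let r0 : 0 < r. Proof. exact: chaos_radius_gt0 th0 expG. Qed.

(** Chernoff's bound at the largest admissible rate [r]; weights of size at most 1 keep each block
    in the range of [block_mgf]. *)
Lemma block_upper_tail (e : nat -> R) (t : R) : (forall i, `|e i| <= 1) ->
  (P [set w | (t <= \sum_(i < m) e i * B i w)%R] <= (expR (- (r * t)) * K ^+ m)%:E)%E.
Proof.
move=> e1.
have mB i : (i < m)%N -> measurable_fun setT (B i).
  by move=> im; exact: (measurable_fun_past mZ (measurable_block im)).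
have er i : `|r * e i| <= r.
  by rewrite normrM (gtr0_norm r0) -[leRHS]mulr1 ler_wpM2l// ltW.
have K0 : 0 <= K.
  rewrite /K /chaos_const addr_ge0// mulr_ge0 ?expR_ge0// addr_ge0//.
  exact: tail_const_ge0 th0 expG.
apply: (@le_trans _ _ (\int[P]_w ((expR (- (r * t)))%:E *
  (\prod_(i < m) expR (r * e i * B i w))%:E))%E).
  have -> : (\int[P]_w ((expR (- (r * t)))%:E *
     (\prod_(i < m) expR (r * e i * B i w))%:E))%E =
     (\int[P]_w (expR (r * (\sum_(i < m) e i * B i w - t)))%:E)%E.
    apply: eq_integral => w _; rewrite -EFinM -expR_sum -expRD; congr (expR _)%:E.
    rewrite mulrBr mulr_sumr addrC; congr (_ - _).
    by apply: eq_bigr => i _; rewrite mulrA.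
  have mS : measurable_fun setT (fun w => \sum_(i < m) e i * B i w).
    by apply: measurable_sum => i; apply: measurable_funM => //; exact: mB.
  apply: measure_le_integral => //.
  - exact: measurable_set_ler.
  - apply: measurableT_comp => //; apply: measurable_funM => //.
    exact: measurable_funB.
  - by move=> w /= tS; rewrite -expR0 ler_expR mulr_ge0 ?subr_ge0// ltW.
rewrite ge0_integralZl//; last 2 first.
- apply/measurable_EFinP; apply: measurable_prod => i _.
  apply: measurableT_comp => //; apply: measurable_funM => //; exact: mB.
- by move=> w _; rewrite lee_fin prodr_ge0// => i _; exact: expR_ge0.
rewrite EFinM lee_pmul2l ?lte_fin ?expR_gt0//.
apply: (@integral_prod_past_le blk (fun i w => expR (r * e i * B i w))) => //.
- move=> i im; apply: measurableT_comp => //; apply: measurable_funM => //.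
  exact: measurable_block.
- by move=> i im; exact: block_mgf.
Qed.

Definition fourth_const : R := 24 / r ^+ 4 * (K + K).

Lemma block_fourth_moment i : (i < m)%N ->
  (\int[P]_w (B i w ^+ 4)%:E <= fourth_const%:E)%E.
Proof.
move=> im.
have mB : measurable_fun setT (B i) := measurable_fun_past mZ (measurable_block im).
have mE (l : R) : measurable_fun setT (fun w => expR (l * B i w)).
  by apply: measurableT_comp => //; apply: measurable_funM.
have a0 : 0 <= 24 / r ^+ 4 by rewrite divr_ge0// exprn_ge0// ltW.
apply: (@le_trans _ _ (\int[P]_w ((24 / r ^+ 4)%:E *
   ((expR (r * B i w))%:E + (expR (- r * B i w))%:E)))%E).
  apply: ge0_le_integral => //.
  - by move=> w _; rewrite lee_fin exprn_even_ge0.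
  - by apply/measurable_EFinP; exact: measurable_funX.
  - by apply: measurable_funeM; apply: emeasurable_funD; exact/measurable_EFinP.
  - move=> w _; rewrite -EFinD -EFinM lee_fin mulNr; exact: pow4_le_expR.
rewrite ge0_integralZl//; last 2 first.
- by apply: emeasurable_funD; exact/measurable_EFinP.
- by move=> w _; rewrite adde_ge0.
rewrite ge0_integralD//; try exact/measurable_EFinP.
rewrite [X in (_ <= X)%E]EFinM; apply: lee_pmul => //.
- by rewrite adde_ge0//; exact: integral_ge0.
- rewrite EFinD; apply: leeD; apply: block_mgf => //; rewrite ?normrN gtr0_norm//.
Qed.

Variables (s e : R).
Hypothesis e01 : 0 <= e <= 1.
Hypothesis es : e * fourth_const <= s / 2.
Hypothesis cy : s <= \sum_(j < N) (\sum_(i < j) c j i ^+ 2 + (m4 mu - 1) * y j ^+ 2).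

(** [expRN_le_quartic] with [eta = sqrt e]: the second moment, at least [s], gains [e s / 2], and by
    [es] the fourth moment gives back at most half of it. *)
Lemma block_laplace i : (i < m)%N ->
  (\int[P]_w (expR (- `|B i w|))%:E <= (expR (- (e * s / 4)))%:E)%E.
Proof.
move=> im.
have mB : measurable_fun setT (B i) := measurable_fun_past mZ (measurable_block im).
have [e0 e1] := andP e01.
pose eta := Num.sqrt e.
have eta01 : 0 <= eta <= 1.
  by rewrite sqrtr_ge0 -[X in _ <= X]sqrtr1 ler_wsqrtr.
have eta2 : eta ^+ 2 = e by rewrite sqr_sqrtr.
have eta4 : eta ^+ 4 = e ^+ 2 by rewrite -eta2 -exprM.
have mX k : measurable_fun setT (fun w => B i w ^+ k) by exact: measurable_funX.
have h : (\int[P]_w (expR (- `|B i w|))%:E + (e / 2 * s)%:E <=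
    1 + (e ^+ 2 / 2 * fourth_const)%:E)%E.
  apply: (@le_trans _ _ (\int[P]_w ((expR (- `|B i w|))%:E +
      (e / 2)%:E * (B i w ^+ 2)%:E))%E).
    rewrite ge0_integralD//; last 3 first.
    - by apply/measurable_EFinP; apply: measurableT_comp => //; apply: measurable_funN; exact: measurableT_comp.
    - by move=> w _; rewrite -EFinM lee_fin mulr_ge0 ?sqr_ge0// divr_ge0.
    - by apply: measurable_funeM; exact/measurable_EFinP.
    rewrite leeD2l// ge0_integralZl//; last 3 first.
    - exact/measurable_EFinP.
    - by move=> w _; rewrite lee_fin sqr_ge0.
    - by rewrite lee_fin divr_ge0.
    rewrite (chaos_second_moment th0 expG mean0 var1 lawZ indZ (vi_inj im))//.
    by rewrite -EFinM lee_fin ler_wpM2l// divr_ge0.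
  apply: (@le_trans _ _ (\int[P]_w (1 + (e ^+ 2 / 2)%:E * (B i w ^+ 4)%:E))%E).
    apply: ge0_le_integral => //.
    - by move=> w _; rewrite -EFinM -EFinD lee_fin addr_ge0 ?expR_ge0// mulr_ge0 ?sqr_ge0// divr_ge0.
    - apply: emeasurable_funD.
        by apply/measurable_EFinP; apply: measurableT_comp => //; apply: measurable_funN; exact: measurableT_comp.
      by apply: measurable_funeM; exact/measurable_EFinP.
    - by apply: emeasurable_funD => //; apply: measurable_funeM; exact/measurable_EFinP.
    - move=> w _; rewrite -!EFinM -!EFinD lee_fin.
      have := expRN_le_quartic (B i w) eta01; rewrite eta2 eta4.
      by rewrite mulrAC => h; apply: le_trans h _; rewrite (mulrAC (e ^+ 2)).
  rewrite ge0_integralD//; last 2 first.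
  - by move=> w _; rewrite -EFinM lee_fin mulr_ge0 ?exprn_even_ge0// divr_ge0// sqr_ge0.
  - by apply: measurable_funeM; exact/measurable_EFinP.
  rewrite integral_prob_cst leeD2l// ge0_integralZl//; last 3 first.
  - exact/measurable_EFinP.
  - by move=> w _; rewrite lee_fin exprn_even_ge0.
  - by rewrite lee_fin divr_ge0// sqr_ge0.
  rewrite [X in (_ <= X)%E]EFinM; apply: lee_pmul => //.
  - by rewrite lee_fin divr_ge0// sqr_ge0.
  - by apply: integral_ge0 => w _; rewrite lee_fin exprn_even_ge0.
  - exact: block_fourth_moment.
have {}h : (\int[P]_w (expR (- `|B i w|))%:E <=
    (1 + e ^+ 2 / 2 * fourth_const - e / 2 * s)%:E)%E.
  by rewrite EFinB EFinD leeBrDr.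
apply: (le_trans h); rewrite lee_fin.
apply: le_trans (expR_ge1Dx _).
have := ler_wpM2l (divr_ge0 e0 (ler0n _ 2)) es.
by rewrite expr2; lra.
Qed.

(** Markov's inequality for [exp(- sum |B_i|)]: half of the Laplace exponent [e s / 4] pays for the
    threshold, half remains as the rate. *)
Lemma block_lower_tail :
  (P [set w | (\sum_(i < m) `|B i w| <= e * s / 8 * m%:R)%R] <=
   (expR (- (e * s / 8 * m%:R)))%:E)%E.
Proof.
have mB i : (i < m)%N -> measurable_fun setT (B i).
  by move=> im; exact: (measurable_fun_past mZ (measurable_block im)).
set t := e * s / 8 * m%:R.
apply: (@le_trans _ _ (\int[P]_w ((expR t)%:E *
  (\prod_(i < m) expR (- `|B i w|))%:E))%E).
  have -> : (\int[P]_w ((expR t)%:E * (\prod_(i < m) expR (- `|B i w|))%:E))%E =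
     (\int[P]_w (expR (t - \sum_(i < m) `|B i w|))%:E)%E.
    apply: eq_integral => w _; rewrite -EFinM -expR_sum -expRD; congr (expR _)%:E.
    by rewrite sumrN.
  have mS : measurable_fun setT (fun w => \sum_(i < m) `|B i w|).
    by apply: measurable_sum => i; apply: measurableT_comp => //; exact: mB.
  apply: measure_le_integral => //.
  - exact: measurable_set_ler.
  - apply: measurableT_comp => //; exact: measurable_funB.
  - by move=> w /= tS; rewrite -expR0 ler_expR subr_ge0.
rewrite ge0_integralZl//; last 2 first.
- apply/measurable_EFinP; apply: measurable_prod => i _.
  apply: measurableT_comp => //; apply: measurable_funN; apply: measurableT_comp => //.
  exact: mB.
- by move=> w _; rewrite lee_fin prodr_ge0// => i _; exact: expR_ge0.
apply: (@le_trans _ _ ((expR t)%:E * ((expR (- (e * s / 4))) ^+ m)%:E)%E).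
  rewrite lee_pmul2l ?lte_fin ?expR_gt0//.
  apply: (@integral_prod_past_le blk (fun i w => expR (- `|B i w|))) => //.
  - move=> i im; apply: measurableT_comp => //; apply: measurable_funN.
    by apply: measurableT_comp => //; exact: measurable_block.
  - by move=> i im; exact: block_laplace.
rewrite -EFinM lee_fin -expRM_natl -expRD ler_expR /t.
by rewrite le_eqVlt; apply/orP; left; apply/eqP; field.
Qed.

End blocks.

(** * Differences of measurements as a chaos *)

Lemma sum_triangle (R : realType) (F : nat -> nat -> R) N :
  \sum_(j < N) (F j j + \sum_(i < j) (F i j + F j i)) =
  \sum_(i < N) \sum_(j < N) F i j.
Proof.
elim: N => [|N IH]; first by rewrite !big_ord0.
rewrite big_ord_recr/= IH [in RHS]big_ord_recr/=.
under [in RHS]eq_bigr do rewrite big_ord_recr/=.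
by rewrite !big_split/= [\sum_(j < N.+1) F N j]big_ord_recr/=; ring.
Qed.

(** The centring of the squares contributes minus the trace; off the diagonal, the two entries of a
    transposed pair merge into one coefficient. *)
Lemma chaos_quadratic (R : realType) d (T : measurableType d) (I : finType)
    (Z : I -> T -> R) (v : nat -> I) (Y : nat -> nat -> R) N w :
  chaos Z v (fun j i => Y i j + Y j i) (fun j => Y j j) N w =
  \sum_(i < N) \sum_(j < N) Y i j * (Z (v i) w * Z (v j) w) - \sum_(j < N) Y j j.
Proof.
rewrite -(sum_triangle (fun i j => Y i j * (Z (v i) w * Z (v j) w))) -sumrB.
apply: eq_bigr => j _; rewrite /chaos_coef mulr_suml.
have -> : \sum_(i < j) (Y i j + Y j i) * Z (v i) w * Z (v j) w =
    \sum_(i < j) (Y i j * (Z (v i) w * Z (v j) w) + Y j i * (Z (v j) w * Z (v i) w)).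
  by apply: eq_bigr => i _; ring.
by ring.
Qed.

Section doubled_matrix.
Context (R : realType) (n0 : nat).
Local Notation n := n0.+1.

(* The quadratic form of [diag(Y, -Y)] in the concatenation of two sensing
   vectors is the difference of the two measurements of [Y]. *)
Definition dbl (Y : 'M[R]_n) (p q : nat) : R :=
  if (p < n)%N && (q < n)%N then Y (inord p) (inord q)
  else if (n <= p)%N && (n <= q)%N then - Y (inord (p - n)) (inord (q - n))
  else 0.

Lemma sum_dbl (Y : 'M[R]_n) (f : nat -> nat -> R -> R) :
  (forall p q, f p q 0 = 0) ->
  \sum_(p < n + n) \sum_(q < n + n) f p q (dbl Y p q) =
  \sum_(i < n) \sum_(j < n) (f i j (Y i j) + f (n + i)%N (n + j)%N (- Y i j)).
Proof.
move=> f0; rewrite big_split_ord/= -big_split/=.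
rewrite (eq_bigr (fun i : 'I_n => \sum_(j < n) f i j (Y i j) +
  \sum_(j < n) f (n + i)%N (n + j)%N (- Y i j))); last first.
  move=> i _; rewrite !big_split_ord/=.
  rewrite [X in _ + X + _]big1 ?addr0; last first.
    by move=> j _; rewrite /dbl ltn_ord ltnNge leq_addr/= leqNgt ltn_ord.
  rewrite [X in _ + (X + _)]big1 ?add0r; last first.
    by move=> j _; rewrite /dbl ltn_ord ltnNge leq_addr/= [(n <= j)%N]leqNgt ltn_ord.
  congr (_ + _); apply: eq_bigr => j _; rewrite /dbl.
    by rewrite !ltn_ord/= !inord_val.
  by rewrite ltnNge leq_addr/= leq_addr !addKn !inord_val.
by apply: eq_bigr => i _; rewrite big_split.
Qed.

(** This cancellation makes a difference of measurements exactly a centred chaos. *)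
Lemma sum_dbl_diag (Y : 'M[R]_n) : \sum_(j < n + n) dbl Y j j = 0.
Proof.
rewrite big_split_ord/= -big_split big1//= => i _.
by rewrite /dbl ltn_ord/= ltnNge leq_addr/= addKn !inord_val subrr.
Qed.

Lemma sum_dbl_sqr (Y : 'M[R]_n) :
  \sum_(p < n + n) \sum_(q < n + n) dbl Y p q ^+ 2 =
  2 * \sum_(i < n) \sum_(j < n) Y i j ^+ 2.
Proof.
rewrite (sum_dbl Y (f := fun _ _ x => x ^+ 2)); last by move=> _ _; rewrite expr0n.
rewrite mulr_sumr; apply: eq_bigr => i _; rewrite mulr_sumr; apply: eq_bigr => j _.
by ring.
Qed.

Definition dbl_off (Y : 'M[R]_n) (j i : nat) : R := dbl Y i j + dbl Y j i.
Definition dbl_diag (Y : 'M[R]_n) (j : nat) : R := dbl Y j j.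

Let fro2 (Y : 'M[R]_n) : R := \sum_(i < n) \sum_(j < n) Y i j ^+ 2.

Lemma dbl_diag_sqr (Y : 'M[R]_n) :
  \sum_(j < n + n) dbl_diag Y j ^+ 2 <= 2 * fro2 Y.
Proof.
rewrite -sum_dbl_sqr; apply: ler_sum => j _; rewrite (bigD1 j)//= lerDl.
by apply: sumr_ge0 => i _; exact: sqr_ge0.
Qed.

Lemma dbl_off_sqr (Y : 'M[R]_n) :
  \sum_(j < n + n) \sum_(i < j) dbl_off Y j i ^+ 2 <= 4 * fro2 Y.
Proof.
rewrite (_ : 4 * fro2 Y = 2 * (2 * fro2 Y)); last by ring.
rewrite -sum_dbl_sqr -(sum_triangle (fun p q => dbl Y p q ^+ 2)) mulr_sumr.
apply: ler_sum => j _; rewrite mulrDr mulr_sumr.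
apply: ler_wpDl; first by rewrite mulr_ge0// sqr_ge0.
apply: ler_sum => i _; rewrite /dbl_off.
by have := sqr_ge0 (dbl Y i j - dbl Y j i); lra.
Qed.

(** By symmetry an off-diagonal pair has coefficient [2 Y_ij], whose square is twice the sum of the
    two squared entries; diagonal entries count with [kur], and [tau] is below both factors. *)
Lemma dbl_variance (Y : 'M[R]_n) (tau kur : R) : Y^T = Y -> tau <= 2 -> tau <= kur ->
  2 * tau * fro2 Y <= \sum_(j < n + n)
    (\sum_(i < j) dbl_off Y j i ^+ 2 + kur * dbl_diag Y j ^+ 2).
Proof.
move=> symY t2 tk.
have Ysym i j : Y i j = Y j i by rewrite -[in LHS]symY mxE.
have dsym p q : dbl Y p q = dbl Y q p.
  by rewrite /dbl [(q < n)%N && _]andbC [(n <= q)%N && _]andbC !(Ysym (inord p))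
    (Ysym (inord (p - n))).
rewrite (_ : 2 * tau * fro2 Y = tau * (2 * fro2 Y)); last by ring.
rewrite -sum_dbl_sqr -(sum_triangle (fun p q => dbl Y p q ^+ 2)) mulr_sumr.
apply: ler_sum => j _; rewrite mulrDr addrC mulr_sumr.
apply: lerD; last by rewrite ler_wpM2r// sqr_ge0.
apply: ler_sum => i _; rewrite /dbl_off (dsym j i).
rewrite [leRHS](_ : _ = 2 * (dbl Y i j ^+ 2 + dbl Y i j ^+ 2)); last by ring.
by rewrite ler_wpM2r// addr_ge0// sqr_ge0.
Qed.

End doubled_matrix.

(** * Differences of paired measurements *)

Section pairs.
Context (R : realType) d (T : measurableType d) (m0 n0 : nat).
Local Notation m := m0.+1.
Local Notation n := n0.+1.
Variable Z : 'I_m * 'I_n -> T -> R.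
Variable h : nat.
Hypothesis hm : (h + h <= m)%N.

(** Coordinates of the concatenation of the sensing vectors [i] and [h + i]; distinct [i < h] use
    disjoint coordinates. *)
Definition pair_idx (i p : nat) : 'I_m * 'I_n :=
  if (p < n)%N then (inord i, inord p) else (inord (h + i), inord (p - n)).

Lemma pair_idx_inj i p j q : (i < h)%N -> (p < n + n)%N -> (j < h)%N ->
  (q < n + n)%N -> pair_idx i p = pair_idx j q -> i = j /\ p = q.
Proof.
move=> ih pn jh qn.
have im : (i < m)%N by apply: leq_trans hm; rewrite ltn_addr.
have jm : (j < m)%N by apply: leq_trans hm; rewrite ltn_addr.
have him : (h + i < m)%N by apply: leq_trans hm; rewrite ltn_add2l.
have hjm : (h + j < m)%N by apply: leq_trans hm; rewrite ltn_add2l.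
have pn' : (n <= p)%N -> (p - n < n)%N by move=> np; rewrite ltn_subLR.
have qn' : (n <= q)%N -> (q - n < n)%N by move=> nq; rewrite ltn_subLR.
rewrite /pair_idx; case: ltnP => [pl|pl]; case: ltnP => [ql|ql] [];
  move=> /(congr1 val) + /(congr1 val); rewrite /= ?inordK ?pn' ?qn'//.
- by move=> ijE; move: ih; rewrite ijE ltnNge leq_addr.
- by move=> ijE; move: jh; rewrite -ijE ltnNge leq_addr.
- by move=> /addnI -> pq; split=> //; rewrite -(subnK pl) pq subnK.
Qed.

Definition pair_form (w : T) (X : 'M[R]_n) (i : nat) : R :=
  let a (k : nat) : 'cV[R]_n := \col_j Z (inord k, j) w in
  ((a i)^T *m X *m a i) 0 0 - ((a (h + i)%N)^T *m X *m a (h + i)%N) 0 0.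

Lemma quad_formE (X : 'M[R]_n) (a : 'cV[R]_n) :
  (a^T *m X *m a) 0 0 = \sum_(i < n) \sum_(j < n) X i j * (a i 0 * a j 0).
Proof.
rewrite mxE exchange_big/=; apply: eq_bigr => j _; rewrite mxE mulr_suml.
by apply: eq_bigr => i _; rewrite mxE; ring.
Qed.

Lemma pair_form_chaos w X i :
  pair_form w X i = chaos Z (pair_idx i) (dbl_off X) (dbl_diag X) (n + n) w.
Proof.
rewrite chaos_quadratic sum_dbl_diag subr0.
rewrite (sum_dbl X (f := fun p q x =>
  x * (Z (pair_idx i p) w * Z (pair_idx i q) w))); last by move=> *; rewrite mul0r.
rewrite /pair_form !quad_formE -sumrB; apply: eq_bigr => p _.
rewrite -sumrB; apply: eq_bigr => q _; rewrite !mxE.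
rewrite /pair_idx !ltn_ord !ltnNge !leq_addr/= !addKn !inord_val.
by ring.
Qed.

Lemma pair_formE w X i : pair_form w X i = \sum_(p : 'I_n * 'I_n)
  (Z (inord i, p.1) w * Z (inord i, p.2) w -
   Z (inord (h + i), p.1) w * Z (inord (h + i), p.2) w) * X p.1 p.2.
Proof.
rewrite /pair_form !quad_formE -sumrB [RHS](_ : _ = \sum_(p < n) \sum_(q < n)
  (Z (inord i, p) w * Z (inord i, q) w -
   Z (inord (h + i), p) w * Z (inord (h + i), q) w) * X p q); last first.
  by rewrite pair_big.
apply: eq_bigr => p _; rewrite -sumrB; apply: eq_bigr => q _; rewrite !mxE.
by ring.
Qed.

Lemma pair_formZ w (b : R) X i : pair_form w (b *: X) i = b * pair_form w X i.
Proof.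
rewrite !pair_formE mulr_sumr; apply: eq_bigr => p _; rewrite mxE; ring.
Qed.

Lemma pair_form_le_Aop w X : \sum_(i < h) `|pair_form w X i| <=
  vnorm1 (Aop (fun i => \col_j Z (i, j) w) X).
Proof.
pose A (k : nat) := `|((\col_j Z (inord k, j) w)^T *m X *m (\col_j Z (inord k, j) w)
    : 'M[R]_1) 0 0|.
apply: (@le_trans _ _ (\sum_(i < h) (A i + A (h + i)%N))).
  by apply: ler_sum => i _; exact: ler_normB.
have -> : vnorm1 (Aop (fun i => \col_j Z (i, j) w) X) = \sum_(k < m) A k.
  by apply: eq_bigr => k _; rewrite mxE /A inord_val.
rewrite big_split/= (_ : _ + _ = \sum_(k < h + h) A k); last first.
  by rewrite big_split_ord.
rewrite -!(big_mkord xpredT A) (big_cat_nat (n := h + h) _ hm)//= lerDl.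
by apply: sumr_ge0 => k _; exact: normr_ge0.
Qed.

End pairs.

(** * The net and the restricted lower bound *)

Section grid.
Context (R : realType) (N : nat).

(* [grid] enumerates the integers of absolute value at most [N]: the first [N]
   indices are the negative ones. *)
Definition grid := 'I_(N + N.+1).

Definition gmag (s : grid) : nat :=
  match fintype.split s with inl k => k.+1 | inr k => k end.

Definition gval (s : grid) : R :=
  match fintype.split s with inl k => - k.+1%:R | inr k => k%:R end.

Lemma norm_gval s : `|gval s| = (gmag s)%:R.
Proof. by rewrite /gval /gmag; case: fintype.split => k; rewrite ?normrN normr_nat. Qed.

Lemma gval_surj (b : bool) k : (k <= N)%N ->
  exists2 s : grid, gval s = (-1) ^+ b * k%:R & gmag s = k.
Proof.
move=> kN; case: b; last first.
  exists (unsplit (inr (Ordinal (kN : (k < N.+1)%N)))).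
    by rewrite /gval unsplitK expr0 mul1r.
  by rewrite /gmag unsplitK.
case: k kN => [|k] kN.
  by exists (unsplit (inr ord0)); rewrite /gval /gmag unsplitK ?mulr0.
exists (unsplit (inl (Ordinal kN))).
  by rewrite /gval unsplitK /= expr1 mulN1r.
by rewrite /gmag unsplitK.
Qed.

Lemma gmag_lshift (k : 'I_N) : gmag (lshift N.+1 k) = k.+1.
Proof. by rewrite /gmag -[lshift _ _]/(unsplit (inl k)) unsplitK. Qed.

Lemma gmag_rshift (k : 'I_N.+1) : gmag (rshift N k) = k.
Proof. by rewrite /gmag -[rshift _ _]/(unsplit (inr k)) unsplitK. Qed.

Lemma sum_gmag (x : R) : 0 < x <= 1 / 2 -> \sum_(s : grid) x ^+ gmag s <= expR (4 * x).
Proof.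
move=> /andP[x0 x2].
rewrite big_split_ord/=.
under eq_bigr do rewrite gmag_lshift.
under [X in _ + X]eq_bigr do rewrite gmag_rshift.
rewrite [X in _ + X]big_ord_recl/= expr0.
(* The subtracted term makes the induction close; it is where [x <= 1 / 2] enters. *)
have geo k : \sum_(i < k) x ^+ i.+1 <= 2 * x - 2 * x ^+ k.+1.
  elim: k => [|k IH]; first by rewrite big_ord0 expr1 subrr.
  rewrite big_ord_recr/=; apply: (le_trans (lerD IH (lexx _))).
  have : x * x ^+ k.+1 <= 1 / 2 * x ^+ k.+1 by rewrite ler_wpM2r// exprn_ge0// ltW.
  by rewrite [x ^+ k.+2]exprS; lra.
have geo' : \sum_(i < N) x ^+ i.+1 <= 2 * x.
  by apply: (le_trans (geo N)); rewrite gerBl mulr_ge0// exprn_ge0// ltW.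
apply: le_trans (expR_ge1Dx _).
by rewrite (eq_bigr (fun i : 'I_N => x ^+ i.+1))//; move: geo'; lra.
Qed.

(* Generating function bound: weigh each point by [x ^+ (|t|_1 - N)]. *)
Lemma card_grid_ball (J : finType) (x : R) : 0 < x <= 1 / 2 ->
  #|[set t : {ffun J -> grid} | (\sum_p gmag (t p) <= N)%N]%SET|%:R <=
  x ^- N * expR (4 * x * #|J|%:R).
Proof.
move=> x02; have /andP[x0 x2] := x02.
rewrite mulrC -ler_pdivrMr ?invr_gt0 ?exprn_gt0// invrK.
rewrite -sum1_card natr_sum mulr_suml.
apply: (@le_trans _ _ (\sum_(t : {ffun J -> grid}) \prod_p x ^+ gmag (t p))).
  rewrite big_mkcond/=; apply: ler_sum => t _.
  have P0 : 0 <= \prod_p x ^+ gmag (t p).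
    by apply: prodr_ge0 => p _; rewrite exprn_ge0// ltW.
  case: ifPn => //; rewrite inE => tN; rewrite mul1r -expr_sum.
  by rewrite ler_wiXn2l// ?ltW//; lra.
rewrite -(bigA_distr_bigA (fun (_ : J) s => x ^+ gmag s)) prodr_const.
rewrite expRM_natr lerXn2r ?nnegrE ?expR_ge0 ?sum_gmag//.
by apply: sumr_ge0 => s _; rewrite exprn_ge0// ltW.
Qed.

End grid.

(** * Linear forms on vectors with bounded entries and bounded l1-norm *)

Section top_entries.
Context (R : realType) (J : finType).

(** [S] maximises the sum of [|g p|] over sets of size at most [N]. A threshold [tau] separating [S]
    from its complement acts as a Lagrange multiplier for the l1 constraint, and the bound holds
    term by term before summation. *)
Lemma linear_form_le_top (N : nat) (g x : J -> R) (al : R) : (0 < N)%N -> 0 <= al ->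
  (forall p, `|x p| <= al) -> \sum_p `|x p| <= al * N%:R ->
  exists2 S : {set J}, (#|S| <= N)%N & \sum_p g p * x p <= al * \sum_(p in S) `|g p|.
Proof.
move=> N0 al0 xal xN.
pose F (S : {set J}) : R := \sum_(p in S) `|g p|.
have Pset0 : (#|(finset.set0 : {set J})| <= N)%N by rewrite cards0.
case: (@Order.TotalTheory.arg_maxP _ _ _ finset.set0 (fun S : {set J} => (#|S| <= N)%N) F Pset0).
move=> S SN Smax; exists S => //.
suff [tau [tau0 tS tnS tN]] : exists tau : R, [/\ 0 <= tau,
    forall p, p \in S -> tau <= `|g p|, forall p, p \notin S -> `|g p| <= tau &
    tau * N%:R <= tau * #|S|%:R].
  apply: (@le_trans _ _ (\sum_p (tau * `|x p| +
      (if p \in S then al * (`|g p| - tau) else 0)))).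
    apply: ler_sum => p _; apply: (le_trans (ler_norm _)); rewrite normrM.
    have x0 := normr_ge0 (x p).
    case: ifPn => pS.
      have gt0 : 0 <= `|g p| - tau by rewrite subr_ge0 tS.
      by have := ler_wpM2l gt0 (xal p); lra.
    rewrite addr0 ler_wpM2r// tnS//.
  rewrite big_split/= -mulr_sumr -big_mkcond/= -mulr_sumr sumrB sumr_const.
  have := ler_wpM2l tau0 xN; have := ler_wpM2l al0 tN.
  rewrite -mulr_natr; lra.
(* If [S] has room left, maximality makes [g] vanish outside [S] and [tau = 0] works; otherwise
   [tau] is the least [|g p|] on [S], by exchanging one element. *)
have [SN'|SN'] := ltnP #|S| N.
  exists 0; split=> // [p pS|]; last by rewrite !mul0r.
  have : (#|(p |: S)%SET| <= N)%N by rewrite cardsU1 pS.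
  by move=> /Smax; rewrite /F big_setU1//= gerDr.
have SNE : #|S| = N by apply/eqP; rewrite eqn_leq SN SN'.
have [p0 p0S] : exists p, p \in S.
  by apply/set0Pn; rewrite -card_gt0 SNE.
case: (@Order.TotalTheory.arg_minP _ _ _ p0 (fun p => p \in S) (fun p => `|g p|) p0S).
move=> p1 p1S p1min; exists `|g p1|; split=> // [q qS|]; last by rewrite SNE.
have : (#|(q |: (S :\ p1))%SET| <= N)%N.
  by rewrite cardsU1 !inE (negbTE qS) andbF/= -SNE (cardsD1 p1 S) p1S.
move=> /Smax; rewrite /F big_setU1 ?inE ?(negbTE qS) ?andbF//=.
by rewrite [leRHS](big_setD1 p1)//= lerD2r.
Qed.

End top_entries.

(** * Rounding a real number towards 0 on the scaled grid *)

Section rounding.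
Context (R : realType) (N : nat) (al : R).
Hypothesis al0 : 0 < al.

Let good (y : R) (s : grid N) :=
  (`|al * gval R s| <= `|y|) && (`|y - al * gval R s| <= al) &&
  (`|y - al * gval R s| <= `|y|).

(** The default is the grid point 0, not reached when [|y| <= al * N%:R]. Being a function of the
    value alone, the rounding preserves symmetry of a matrix. *)
Definition rnd (y : R) : grid N :=
  odflt (unsplit (inr ord0)) [pick s | good y s].

Lemma rnd_good y : `|y| <= al * N%:R ->
  [/\ `|al * gval R (rnd y)| <= `|y|, `|y - al * gval R (rnd y)| <= al &
      `|y - al * gval R (rnd y)| <= `|y|].
Proof.
move=> yN; pose k := Num.truncn (`|y| / al).
have ya0 : 0 <= `|y| / al by rewrite divr_ge0// ltW.
have kN : (k <= N)%N.
  rewrite -ltnS truncn_lt_nat// ltr_pdivrMr// (le_lt_trans yN)// mulrC ltr_pM2r//.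
  by rewrite ltr_nat.
have /andP[k1 k2] := truncn_itv ya0; rewrite -/k in k1 k2.
move: k1 k2; rewrite ler_pdivlMr// ltr_pdivrMr// -natr1 mulrDl mul1r => k1 k2.
have [s sE _] := @gval_surj R N (y < 0) k kN.
rewrite /rnd; case: pickP => [s' /andP[/andP[]]//|/(_ s)].
suff -> : good y s by [].
have ka0 : 0 <= k%:R * al by rewrite mulr_ge0// ltW.
rewrite /good sE; case: ltP => y0.
  rewrite expr1 mulN1r mulrN opprK normrN; rewrite (ltr0_norm y0) in k1 k2 *.
  by rewrite [al * _]mulrC ger0_norm// ler0_norm; lra.
rewrite expr0 mul1r; rewrite (ger0_norm y0) in k1 k2 *.
by rewrite [al * _]mulrC ger0_norm// ger0_norm; lra.
Qed.

End rounding.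

(** * Deterministic passage from the net to all normalised cone elements *)

Section restricted_lower_bound.
Context (R : realType) (J : finType) (inv : J -> J) (h N : nat).
Variables (g : 'I_h -> J -> R) (al kap : R).
Hypothesis al0 : 0 < al.
Hypothesis N0 : (0 < N)%N.
Hypothesis alN : al ^+ 2 * N%:R <= 1 / 4.

Let form i (x : J -> R) := \sum_p g i p * x p.
Let pt (t : {ffun J -> grid N}) p := al * gval R (t p).

Hypothesis upper : forall (e : {ffun 'I_h -> bool}) (t : {ffun J -> grid N}),
  (\sum_p gmag (t p) <= N)%N -> \sum_p gval R (t p) ^+ 2 <= N%:R ->
  \sum_i (-1) ^+ e i * form i (pt t) <= kap.

Hypothesis lower : forall t : {ffun J -> grid N},
  (\sum_p gmag (t p) <= N)%N -> (forall p, t (inv p) = t p) ->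
  1 / 4 <= \sum_p pt t p ^+ 2 <= 1 ->
  2 * kap <= \sum_i `|form i (pt t)|.

(** Optimal signs [e] turn the sum of absolute values into one linear form [G]; the top-coefficient
    bound is then attained by a flat point with entries [al * sign (G p)] on [S], to which [upper]
    applies. *)
Lemma flat_upper_bound (x : J -> R) : (forall p, `|x p| <= al) ->
  \sum_p `|x p| <= al * N%:R -> \sum_i `|form i x| <= kap.
Proof.
move=> xal xN.
pose e : {ffun 'I_h -> bool} := [ffun i => form i x < 0].
pose G p := \sum_i (-1) ^+ e i * g i p.
have formG y : \sum_i (-1) ^+ e i * form i y = \sum_p G p * y p.
  rewrite /form; under eq_bigr do rewrite mulr_sumr.
  rewrite exchange_big/=; apply: eq_bigr => p _; rewrite mulr_suml.
  by apply: eq_bigr => i _; rewrite mulrA.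
have -> : \sum_i `|form i x| = \sum_p G p * x p.
  rewrite -formG; apply: eq_bigr => i _; rewrite ffunE.
  case: ltP => f0; first by rewrite expr1 mulN1r ltr0_norm.
  by rewrite expr0 mul1r ger0_norm.
have [S SN] := linear_form_le_top G N0 (ltW al0) xal xN.
move=> /le_trans; apply.
have [one oneE oneM] : exists2 s : bool -> grid N,
    (forall b, gval R (s b) = (-1) ^+ b) & (forall b, gmag (s b) = 1%N).
  have [s1 s1E s1M] := @gval_surj R N true 1 N0.
  have [s2 s2E s2M] := @gval_surj R N false 1 N0.
  by exists (fun b => if b then s1 else s2) => -[] //; rewrite ?s1E ?s2E mulr1.
have [z zE zM] := @gval_surj R N false 0 (leq0n N).
rewrite mulr0 in zE.
pose t : {ffun J -> grid N} := [ffun p => if p \in S then one (G p < 0) else z].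
have -> : al * \sum_(p in S) `|G p| = \sum_i (-1) ^+ e i * form i (pt t).
  rewrite formG big_mkcond mulr_sumr/=; apply: eq_bigr => p _.
  rewrite /pt ffunE; case: ifPn => _; last by rewrite zE !mulr0.
  rewrite oneE; case: ltP => G0; first by rewrite expr1 ltr0_norm//; ring.
  by rewrite expr0 ger0_norm//; ring.
apply: upper.
  under eq_bigr do rewrite ffunE (fun_if (@gmag N)) oneM zM.
  by rewrite -big_mkcond/= sum1_card.
under eq_bigr do rewrite ffunE.
rewrite (eq_bigr (fun p => if p \in S then 1 else 0)); last first.
  by move=> p _; case: ifP => _; rewrite ?oneE ?sqrr_sign// zE expr0n.
by rewrite -big_mkcond/= sumr_const ler_nat.
Qed.

(** The rounded point contributes at least [2 * kap] and the remainder removes at most [kap]. Here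
    [inv] stands for transposition of matrix positions. *)
Lemma restricted_lower (x : J -> R) : (forall p, x (inv p) = x p) ->
  \sum_p x p ^+ 2 = 1 -> \sum_p `|x p| <= al * N%:R -> kap <= \sum_i `|form i x|.
Proof.
move=> xsym x2 x1.
have xp p : `|x p| <= al * N%:R.
  by apply: le_trans x1; rewrite (bigD1 p)//= lerDl sumr_ge0.
pose t : {ffun J -> grid N} := [ffun p => rnd N al (x p)].
have tE p : pt t p = al * gval R (rnd N al (x p)) by rewrite /pt ffunE.
pose rem p := x p - pt t p.
have t1 p : `|pt t p| <= `|x p| by rewrite tE; case: (rnd_good al0 (xp p)).
have r1 p : `|rem p| <= al by rewrite /rem tE; case: (rnd_good al0 (xp p)).
have r2 p : `|rem p| <= `|x p| by rewrite /rem tE; case: (rnd_good al0 (xp p)).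
have remN : \sum_p `|rem p| <= al * N%:R.
  by apply: le_trans x1; apply: ler_sum.
have remU := flat_upper_bound r1 remN.
have rem2 : \sum_p rem p ^+ 2 <= 1 / 4.
  apply: le_trans alN; apply: (@le_trans _ _ (al * \sum_p `|rem p|)).
    rewrite mulr_sumr; apply: ler_sum => p _.
    by rewrite -(real_normK (num_real (rem p))) expr2 ler_wpM2r.
  by rewrite expr2 -mulrA ler_wpM2l// ltW.
have ptL : 2 * kap <= \sum_i `|form i (pt t)|.
  apply: lower.
  - rewrite -(ler_nat R) natr_sum -(ler_pM2l al0); apply: le_trans x1.
    rewrite mulr_sumr; apply: ler_sum => p _; rewrite -norm_gval.
    by apply: le_trans (t1 p); rewrite /pt normrM gtr0_norm.
  - by move=> p; rewrite !ffunE xsym.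
  - apply/andP; split; last first.
      rewrite -x2; apply: ler_sum => p _.
      rewrite -(real_normK (num_real (pt t p))) -(real_normK (num_real (x p))).
      by rewrite ler_pXn2r ?nnegrE.
    (* With [rem2] this gives [1 <= 2 |pt|^2 + 1 / 2], hence the lower bound [1 / 4]. *)
    have : \sum_p x p ^+ 2 <= \sum_p (2 * pt t p ^+ 2 + 2 * rem p ^+ 2).
      apply: ler_sum => p _; have := sqr_ge0 (pt t p - rem p).
      rewrite (_ : x p = pt t p + rem p); last by rewrite /rem; ring.
      by lra.
    by rewrite x2 big_split/= -!mulr_sumr; lra.
have : \sum_i `|form i (pt t)| <= \sum_i (`|form i x| + `|form i rem|).
  apply: ler_sum => i _; rewrite (_ : form i (pt t) = form i x - form i rem).
    exact: ler_normB.
  by rewrite /form -sumrB; apply: eq_bigr => p _; rewrite /rem; ring.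
by rewrite big_split/=; lra.
Qed.

End restricted_lower_bound.

(** * Deterministic consequences of minimality and feasibility *)

Section minimizer.
Context (R : realType).

Lemma mnorm1E n (M : 'M[R]_n) : mnorm1 M = \sum_p `|M p.1 p.2|.
Proof. by rewrite /mnorm1 pair_big. Qed.

Lemma sqr_frob n (M : 'M[R]_n) : frob M ^+ 2 = \sum_p M p.1 p.2 ^+ 2.
Proof.
rewrite /frob sqr_sqrtr; first by rewrite pair_big.
apply: sumr_ge0 => i _; by apply: sumr_ge0 => j _; exact: sqr_ge0.
Qed.

Lemma sum_norm_le_sqrt_frob n (M : 'M[R]_n) (S : {set 'I_n * 'I_n}) :
  \sum_(p in S) `|M p.1 p.2| <= Num.sqrt #|S|%:R * frob M.
Proof.
have S2 : \sum_(p in S) M p.1 p.2 ^+ 2 <= frob M ^+ 2.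
  rewrite sqr_frob [leLHS]big_mkcond/=; apply: ler_sum => p _.
  by case: ifP => // _; exact: sqr_ge0.
have f0 : 0 <= frob M by exact: sqrtr_ge0.
have [fE|fE] := eqVneq (frob M) 0.
  rewrite fE mulr0 big1// => p pS; apply/eqP; rewrite normr_eq0 -sqrf_eq0.
  move: S2; rewrite fE expr0n/= => S2.
  rewrite eq_le sqr_ge0 andbT; apply: le_trans S2.
  by rewrite (bigD1 p)//= lerDl sumr_ge0// => q _; exact: sqr_ge0.
have {}f0 : 0 < frob M by rewrite lt_def fE.
have [S0|S0] := posnP #|S|.
  by rewrite (cards0_eq S0) big_set0 mulr_ge0 ?sqrtr_ge0.
set k := Num.sqrt #|S|%:R.
have k0 : 0 < k by rewrite sqrtr_gt0 ltr0n.
have kk : k ^+ 2 = #|S|%:R by rewrite sqr_sqrtr.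
(* Cauchy-Schwarz through the arithmetic-geometric inequality, weighted so that both halves sum to
   [k * frob M / 2]. *)
apply: (@le_trans _ _ (\sum_(p in S) (frob M / (2 * k) +
    k / (2 * frob M) * M p.1 p.2 ^+ 2))).
  apply: ler_sum => p _; rewrite -(real_normK (num_real (M p.1 p.2))).
  rewrite -subr_ge0 [X in 0 <= X](_ : _ =
    (2 * k * frob M)^-1 * (frob M - k * `|M p.1 p.2|) ^+ 2); last first.
    by field; rewrite !gt_eqF.
  by rewrite mulr_ge0 ?sqr_ge0// invr_ge0 !mulr_ge0// ltW.
rewrite big_split/= sumr_const -mulr_sumr -[_ *+ _]mulr_natr -kk.
apply: (@le_trans _ _ (frob M / (2 * k) * k ^+ 2 + k / (2 * frob M) * frob M ^+ 2)).
  by rewrite lerD2l ler_wpM2l// divr_ge0 ?mulr_ge0// ltW.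
by rewrite le_eqVlt; apply/orP; left; apply/eqP; field; rewrite !gt_eqF.
Qed.

(** Entrywise triangle inequalities: [|Sig| <= |Sighat| + |H|] on [S] and [|H| <= |Sighat| + |Sig|]
    off [S]; Cauchy-Schwarz then bounds the part on [S]. *)
Lemma minimizer_cone n k (Sig Sighat : 'M[R]_n) (S : {set 'I_n * 'I_n}) :
  #|S| = k -> mnorm1 Sighat <= mnorm1 Sig ->
  mnorm1 (Sighat - Sig) <= 2 * (Num.sqrt k%:R * frob (Sighat - Sig)) +
    2 * mnorm1 (Sig - restrict_mx S Sig).
Proof.
move=> <- le1; set H := Sighat - Sig.
have hS := sum_norm_le_sqrt_frob H S.
suff : mnorm1 H <= mnorm1 Sighat - mnorm1 Sig + 2 * \sum_(p in S) `|H p.1 p.2|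
    + 2 * mnorm1 (Sig - restrict_mx S Sig) by lra.
rewrite !mnorm1E [\sum_(p in S) _]big_mkcond/= -sumrB !mulr_sumr -!big_split/=.
apply: ler_sum => -[i j] _ /=; rewrite !mxE.
have h1 := ler_normD (Sighat i j) (- (Sighat i j - Sig i j)).
have h2 := ler_normB (Sighat i j) (Sig i j).
rewrite normrN (_ : Sighat i j - (Sighat i j - Sig i j) = Sig i j) in h1; last by ring.
case: ifP => _; first by rewrite subrr normr0; lra.
by rewrite subr0; lra.
Qed.

Lemma minimizer_residual m n (a : 'I_m -> 'cV[R]_n) (Sig Sighat : 'M[R]_n)
    (eta : 'cV[R]_m) (eps : R) : vnorm1 eta <= eps ->
  is_minimizer a (Aop a Sig + eta) eps Sighat -> vnorm1 (Aop a (Sighat - Sig)) <= 2 * eps.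
Proof.
move=> he [_ hhat _].
have AopB i : Aop a (Sighat - Sig) i 0 = Aop a Sighat i 0 - Aop a Sig i 0.
  rewrite [LHS]mxE [X in _ = X - _]mxE [X in _ = _ - X]mxE mulmxBr mulmxBl.
  by rewrite [LHS]mxE [X in _ + X = _]mxE.
apply: (@le_trans _ _ (vnorm1 eta + vnorm1 (Aop a Sig + eta - Aop a Sighat))); last by lra.
rewrite /vnorm1 -big_split/=; apply: ler_sum => i _; rewrite AopB.
set u := Aop a Sighat i 0; set v := Aop a Sig i 0.
have -> : (Aop a Sig + eta - Aop a Sighat) i 0 = v + eta i 0 - u.
  by rewrite mxE [X in X + _]mxE [X in _ + X]mxE.
rewrite (_ : u - v = eta i 0 - (v + eta i 0 - u)); last by ring.
exact: ler_normB.
Qed.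

End minimizer.

(** * The sampling event *)

Section union_bound.
Context d (T : measurableType d) (R : realType) (P : probability T R).
Variables (J : finType) (A : {set J}) (F : J -> set T).

Definition some_event : set T := \bigcup_(x in [set x | x \in A]) F x.

Hypothesis mF : forall x, measurable (F x).

Lemma measurable_some_event : measurable some_event.
Proof. exact: fin_bigcup_measurable. Qed.

Lemma union_bound (b : R) : (forall x, x \in A -> (P (F x) <= b%:E)%E) ->
  (P some_event <= (#|A|%:R * b)%:E)%E.
Proof.
move=> Fb; pose f w : R := \sum_(x <- enum A) \1_(F x) w.
have f0 w : 0 <= f w by exact: sumr_ge0.
have mf : measurable_fun setT f.
  by apply: measurable_sum => x; exact: measurable_indic.
apply: (@le_trans _ _ (\int[P]_w (f w)%:E)%E).
  apply: measure_le_integral => //; first exact: measurable_some_event.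
  move=> w [x /= xA Fxw]; rewrite /f big_enum/= (bigD1 x)//= indicE mem_set//=.
  by rewrite lerDl; apply: sumr_ge0.
rewrite /f; under eq_integral do rewrite -sumEFin.
rewrite ge0_integral_sum//; last first.
  by move=> x; apply/measurable_EFinP; exact: measurable_indic.
rewrite big_enum/=.
apply: (@le_trans _ _ (\sum_(x in A) b%:E)%E).
  by apply: lee_sum => x xA; rewrite integral_indic// setIT; exact: Fb.
by rewrite sumEFin sumr_const mulr_natl.
Qed.

End union_bound.

Lemma ln2_ge_half (R : realType) : 1 / 2 <= ln (2 : R).
Proof.
have h : expR (1 / 2 : R) <= 2.
  have := expR_ge1Dx (- (1 / 2) : R); rewrite expRN.
  have e0 := expR_gt0 (1 / 2 : R).
  rewrite -(@ler_pM2r _ (expR (1 / 2)))// mulVf ?gt_eqF//; lra.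
by rewrite -[leLHS]expRK ler_ln ?posrE ?expR_gt0.
Qed.

(** * The two bad events, their probabilities, and the lower bound off them *)

Section sampling_event.
Context (R : realType) (mu : probability R R) (th G : R).
Hypothesis th0 : 0 < th.
Hypothesis expG : (\int[mu]_x (expR (th * x ^+ 2))%:E = G%:E)%E.
Hypothesis mean0 : (\int[mu]_x (x%:E) = 0)%E.
Hypothesis var1 : (\int[mu]_x ((x ^+ 2)%:E) = 1)%E.
Hypothesis kurt : 1 < m4 mu.

Let r := chaos_radius th G.
Let K := chaos_const th G.
Let Q4 := fourth_const th G.
Let tau : R := Num.min 2 (m4 mu - 1).
Let s := tau / 2.
Let e : R := Num.min 1 (s / (2 * Q4)).

(** [s] is the variance bound [2 * tau * (1 / 4)] for net matrices of squared Frobenius norm at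
    least [1 / 4]; [e] ensures [e * Q4 <= s / 2], as [block_laplace] requires. *)
Definition small_ball_const : R := e * s / 8.
Let rho := small_ball_const.

Let r0 : 0 < r. Proof. exact: chaos_radius_gt0 th0 expG. Qed.

Let K1 : 1 <= K.
Proof.
rewrite /K /chaos_const lerDl mulr_ge0 ?expR_ge0// addr_ge0//.
exact: tail_const_ge0 th0 expG.
Qed.

Let Q40 : 0 < Q4.
Proof.
rewrite /Q4 /fourth_const mulr_gt0 ?divr_gt0 ?exprn_gt0// -/K.
by have := K1; lra.
Qed.

Let s0 : 0 < s. Proof. by rewrite divr_gt0// lt_min ltr0n subr_gt0. Qed.

Let e0 : 0 < e. Proof. by rewrite lt_min ltr01 divr_gt0// mulr_gt0. Qed.

Lemma small_ball_const_gt0 : 0 < rho.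
Proof. by rewrite /rho /small_ball_const divr_gt0// mulr_gt0. Qed.

Variables (l : nat) (om : R).
Hypothesis l2 : (2 <= l)%N.
Hypothesis lbig : K + 3 <= r * l%:R * (rho / 2).
Hypothesis om1 : om <= 1.
Hypothesis om2 : om <= rho / 2.

Variables (m0 n0 k h : nat).
Local Notation m := m0.+1.
Local Notation n := n0.+1.
Hypothesis k0 : (0 < k)%N.
Hypothesis hm : (h + h <= m)%N.
Let N := (16 * k * l ^ 2)%N.
Local Notation J := ('I_n * 'I_n)%type.

Let net : {set {ffun J -> grid N}} := [set t : {ffun J -> grid N} | (\sum_p gmag (t p) <= N)%N]%SET.
Hypothesis net_card : #|net|%:R <= expR (om * h%:R).

Context d (T : measurableType d) (P : probability T R) (Z : 'I_m * 'I_n -> T -> R).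
Hypothesis lawZ : forall i, has_law P (Z i) mu.
Hypothesis indZ : mutually_independent P Z.

(** [nu] normalises flat matrices with [N] entries to Frobenius norm 1. The grid step [al] is [l]
    times smaller, so flat matrices at that scale have norm at most [1 / l], while [al * N%:R]
    equals the cone radius [4 * sqrt k]. *)
Let nu : R := (4 * Num.sqrt k%:R * l%:R)^-1.
Let al : R := nu / l%:R.
Let sk : R := Num.sqrt k%:R.

Let sk0 : 0 < sk. Proof. by rewrite sqrtr_gt0 ltr0n. Qed.
Let skk : sk ^+ 2 = k%:R. Proof. by rewrite sqr_sqrtr. Qed.
Let lR0 : 0 < l%:R :> R. Proof. by rewrite ltr0n (leq_trans _ l2). Qed.
Let nu0 : 0 < nu. Proof. by rewrite invr_gt0 !mulr_gt0. Qed.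
Let al0 : 0 < al. Proof. by rewrite divr_gt0. Qed.
Let NR : N%:R = 16 * sk ^+ 2 * l%:R ^+ 2 :> R.
Proof. by rewrite skk 2!natrM natrX. Qed.
Let nuN : nu ^+ 2 * N%:R = 1.
Proof. by rewrite NR /nu -/sk; field; rewrite !gt_eqF. Qed.
Let N0 : (0 < N)%N.
Proof. by rewrite muln_gt0 muln_gt0 k0 expn_gt0 (leq_trans _ l2). Qed.

Let tm (t : {ffun J -> grid N}) : 'M[R]_n := \matrix_(i, j) gval R (t (i, j)).
Let pf := pair_form Z h.

Let mpf (X : 'M[R]_n) (i : 'I_h) : measurable_fun setT (fun w => pf w X i).
Proof.
under eq_fun do rewrite /pf pair_form_chaos.
apply: (measurable_fun_past (fun i => (lawZ i).1)).
exact: (measurable_chaos (N := (n + n)%N)).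
Qed.

Let ev1 (x : {ffun 'I_h -> bool} * {ffun J -> grid N}) : set T :=
  [set w | rho / 2 * h%:R <= \sum_(i < h) (-1) ^+ x.1 i * pf w (al *: tm x.2) i].
Let idx1 : {set {ffun 'I_h -> bool} * {ffun J -> grid N}} :=
  [set x : {ffun 'I_h -> bool} * {ffun J -> grid N} |
    (x.2 \in net) && (\sum_p gval R (x.2 p) ^+ 2 <= N%:R)%R]%SET.

Let ev2 (t : {ffun J -> grid N}) : set T :=
  [set w | \sum_(i < h) `|pf w (al *: tm t) i| <= rho * h%:R].
Let idx2 : {set {ffun J -> grid N}} :=
  [set t : {ffun J -> grid N} | [&& t \in net, (tm t)^T == tm t &
     (1 / 4 <= \sum_p (al * gval R (t p)) ^+ 2 <= 1)%R]]%SET.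

Let mev1 x : measurable (ev1 x).
Proof.
apply: measurable_set_ler => //; apply: measurable_sum => i.
by apply: measurable_funM => //; exact: mpf.
Qed.

Let mev2 t : measurable (ev2 t).
Proof.
apply: measurable_set_ler => //; apply: measurable_sum => i.
by apply: measurableT_comp => //; exact: mpf.
Qed.

Let fro_tm (b : R) t : \sum_(i < n) \sum_(j < n) (b *: tm t) i j ^+ 2 =
  \sum_p (b * gval R (t p)) ^+ 2.
Proof.
rewrite pair_big/=; apply: eq_bigr => -[i j] _; by rewrite !mxE.
Qed.

(** Rescaling from [al] to [nu] multiplies the threshold by [l]. In [lbig], [K] pays for the moment
    bound and 3 for the [2 ^ h] sign patterns, the net, and the remaining rate, as [om <= 1]. *)
Let ev1_prob : (P (some_event idx1 ev1) <= (expR (- (om * h%:R)))%:E)%E.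
Proof.
pose b := expR (- (r * (l%:R * (rho / 2 * h%:R)))) * K ^+ h.
apply: (@le_trans _ _ (#|idx1|%:R * b)%:E).
  apply: union_bound => // x; rewrite inE => /andP[_ xN].
  have fro1 : \sum_(i < n) \sum_(j < n) (nu *: tm x.2) i j ^+ 2 <= 1.
    rewrite fro_tm; under eq_bigr do rewrite exprMn.
    by rewrite -mulr_sumr -nuN ler_wpM2l// sqr_ge0.
  have c2 : \sum_(j < n + n) \sum_(i < j) dbl_off (nu *: tm x.2) j i ^+ 2 <= 4.
    by apply: (le_trans (dbl_off_sqr _)); rewrite -[leRHS]mulr1 ler_wpM2l.
  have y1 : \sum_(j < n + n) dbl_diag (nu *: tm x.2) j ^+ 2 <= 2.
    by apply: (le_trans (dbl_diag_sqr _)); rewrite -[leRHS]mulr1 ler_wpM2l.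
  (* Extends the signs to all naturals, by 0 beyond [h], to fit [block_upper_tail]. *)
  pose sg i : R := if insub i is Some j then (-1) ^+ x.1 j else 0.
  have sg1 i : `|sg i| <= 1.
    by rewrite /sg; case: insub => [j|]; rewrite ?normr0// normrX normrN1 expr1n.
  have := block_upper_tail th0 expG mean0 var1 lawZ indZ (pair_idx_inj hm) c2 y1
    (l%:R * (rho / 2 * h%:R)) sg1.
  apply: le_trans; rewrite le_eqVlt; apply/orP; left; apply/eqP; congr (P _).
  apply/seteqP; split => w; rewrite /ev1/=.
    rewrite -(ler_pM2l lR0) => /le_trans; apply; rewrite mulr_sumr.
    rewrite le_eqVlt; apply/orP; left; apply/eqP; apply: eq_bigr => i _.
    rewrite -pair_form_chaos /pf !pair_formZ /sg valK /al.
    by field; rewrite gt_eqF.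
  move=> hw; rewrite -(ler_pM2l lR0); apply: (le_trans hw); rewrite mulr_sumr.
  rewrite le_eqVlt; apply/orP; left; apply/eqP; apply: eq_bigr => i _.
  rewrite -pair_form_chaos /pf !pair_formZ /sg valK /al.
  by field; rewrite gt_eqF.
have idxc : #|idx1|%:R <= expR h%:R * expR (om * h%:R).
  apply: (@le_trans _ _ ((2 ^ h * #|net|)%N%:R)).
    rewrite ler_nat (leq_trans (_ : _ <= #|finset.setX [set: {ffun 'I_h -> bool}]%SET net|)%N)//.
      by apply: subset_leq_card; apply/fintype.subsetP => x; rewrite !inE => /andP[].
    by rewrite cardsX cardsT card_ffun card_bool card_ord.
  rewrite natrM ler_pM// natrX -[h%:R]mul1r expRM_natr lerXn2r ?nnegrE ?expR_ge0//.
  by have := expR_ge1Dx (1 : R); lra.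
have Kh : K ^+ h <= expR (K * h%:R).
  rewrite expRM_natr lerXn2r ?nnegrE ?expR_ge0//; first by have := K1; lra.
  by have := expR_ge1Dx K; lra.
rewrite lee_fin.
apply: (@le_trans _ _ (expR h%:R * expR (om * h%:R) *
  (expR (- (r * (l%:R * (rho / 2 * h%:R)))) * expR (K * h%:R)))).
  apply: ler_pM => //; last by rewrite ler_wpM2l ?expR_ge0.
  by rewrite mulr_ge0 ?expR_ge0// exprn_ge0//; have := K1; lra.
rewrite -!expRD ler_expR.
have hh : 0 <= h%:R :> R by [].
have := ler_wpM2r hh lbig; have := ler_wpM2r hh om1.
by rewrite -!mulrA; lra.
Qed.

(** Each point fails with probability at most [exp(- rho h)]; the net costs [exp(om h)], and
    [om <= rho / 2] leaves the rate [om]. *)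
Let ev2_prob : (P (some_event idx2 ev2) <= (expR (- (om * h%:R)))%:E)%E.
Proof.
apply: (@le_trans _ _ (#|idx2|%:R * expR (- (rho * h%:R)))%:E).
  apply: union_bound => // t; rewrite inE => /and3P[_ /eqP tsym /andP[t1 t2]].
  have fro1 : \sum_(i < n) \sum_(j < n) (al *: tm t) i j ^+ 2 <= 1 by rewrite fro_tm.
  have c2 : \sum_(j < n + n) \sum_(i < j) dbl_off (al *: tm t) j i ^+ 2 <= 4.
    by apply: (le_trans (dbl_off_sqr _)); rewrite -[leRHS]mulr1 ler_wpM2l.
  have y1 : \sum_(j < n + n) dbl_diag (al *: tm t) j ^+ 2 <= 2.
    by apply: (le_trans (dbl_diag_sqr _)); rewrite -[leRHS]mulr1 ler_wpM2l.
  have tau0 : 0 <= tau by have := s0; rewrite /s; lra.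
  have cy : s <= \sum_(j < n + n) (\sum_(i < j) dbl_off (al *: tm t) j i ^+ 2 +
      (m4 mu - 1) * dbl_diag (al *: tm t) j ^+ 2).
    apply: le_trans (dbl_variance (tau := tau) _ _ _); last 3 first.
    - by rewrite linearZ/= tsym.
    - by rewrite ge_min lexx.
    - by rewrite ge_min lexx orbT.
    rewrite fro_tm; have := ler_wpM2l (mulr_ge0 (ler0n R 2) tau0) t1.
    by rewrite /s; lra.
  have es : e * Q4 <= s / 2.
    apply: (@le_trans _ _ (s / (2 * Q4) * Q4)).
      by rewrite ler_wpM2r ?(ltW Q40)// ge_min lexx orbT.
    by rewrite le_eqVlt; apply/orP; left; apply/eqP; field; rewrite gt_eqF.
  have e01 : 0 <= e <= 1 by rewrite (ltW e0)/= ge_min lexx.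
  have := block_lower_tail th0 expG mean0 var1 lawZ indZ (pair_idx_inj hm) c2 y1
    e01 es cy.
  apply: le_trans; rewrite le_eqVlt; apply/orP; left; apply/eqP; congr (P _).
  apply/seteqP; split => w; rewrite /ev2/= => hw.
    by under eq_bigr do rewrite -pair_form_chaos.
  by under eq_bigr do rewrite /pf pair_form_chaos.
rewrite lee_fin; apply: (@le_trans _ _ (expR (om * h%:R) * expR (- (rho * h%:R)))).
  rewrite ler_wpM2r ?expR_ge0//; apply: le_trans net_card; rewrite ler_nat.
  by apply: subset_leq_card; apply/fintype.subsetP => t; rewrite !inE => /andP[].
rewrite -expRD ler_expR.
have hh : 0 <= h%:R :> R by [].
by have := ler_wpM2r hh om2; lra.
Qed.

Lemma sampling_event : exists E : set T, [/\ measurable E,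
  ((1 - 2 * expR (- (om * h%:R)))%:E <= P E)%E &
  forall w, E w -> forall H : 'M[R]_n, H^T = H ->
    mnorm1 H <= 4 * Num.sqrt k%:R * frob H ->
    rho / 2 * h%:R * frob H <= \sum_(i < h) `|pair_form Z h w H i|].
Proof.
pose U := some_event idx1 ev1 `|` some_event idx2 ev2.
have mU1 : measurable (some_event idx1 ev1) by exact: measurable_some_event.
have mU2 : measurable (some_event idx2 ev2) by exact: measurable_some_event.
have mU : measurable U by exact: measurableU.
exists (~` U); split.
- exact: measurableC.
- rewrite probability_setC//.
  have PU : (P U <= (2 * expR (- (om * h%:R)))%:E)%E.
    apply: (le_trans (measureU2 _ mU1 mU2)).
    rewrite (_ : 2 * _ = expR (- (om * h%:R)) + expR (- (om * h%:R))); last by ring.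
    by rewrite EFinD; exact: leeD.
  by rewrite EFinB; exact: leeB.
move=> w nU H Hsym Hcone.
have f0 : 0 <= frob H by exact: sqrtr_ge0.
have [fE|fE] := eqVneq (frob H) 0; first by rewrite fE mulr0 sumr_ge0.
have {}f0 : 0 < frob H by rewrite lt_def fE.
pose g (i : 'I_h) (p : J) := Z (inord i, p.1) w * Z (inord i, p.2) w -
  Z (inord (h + i), p.1) w * Z (inord (h + i), p.2) w.
pose x (p : J) := H p.1 p.2 / frob H.
have formE (t : {ffun J -> grid N}) i :
    \sum_p g i p * (al * gval R (t p)) = pf w (al *: tm t) i.
  by rewrite /pf pair_formE; apply: eq_bigr => -[i1 i2] _; rewrite !mxE.
have alN : al * N%:R = 4 * sk.
  by rewrite NR /al /nu -/sk; field; rewrite !gt_eqF.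
have key : rho / 2 * h%:R <= \sum_i `|\sum_p g i p * x p|.
  apply: (@restricted_lower R J (fun p => (p.2, p.1)) h N g al (rho / 2 * h%:R)) => //.
  (* The value is [1 / l^2], at most [1 / 4] since [l] is at least 2. *)
  - rewrite [leLHS](_ : _ = nu ^+ 2 * N%:R / l%:R ^+ 2); last first.
      by rewrite /al; field; rewrite gt_eqF.
    rewrite nuN ler_pdivrMr ?exprn_gt0//.
    have l2R : 2 <= l%:R :> R by rewrite ler_nat.
    by have := ler_pM (ler0n R 2) (ler0n R 2) l2R l2R; rewrite expr2; lra.
  - move=> ee t tN t2; rewrite leNgt; apply/negP => hlt; apply: nU; left.
    exists (ee, t) => /=; first by rewrite !inE tN.
    rewrite /ev1/=; under eq_bigr do rewrite -formE; exact: ltW.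
  - move=> t tN tsym t14; rewrite leNgt; apply/negP => hlt; apply: nU; right.
    exists t => /=.
      rewrite !inE tN t14 andbT/=; apply/eqP/matrixP => i j; rewrite !mxE.
      have tji : t (j, i) = t (i, j) := tsym (i, j).
      by rewrite tji.
    rewrite /ev2/=; under eq_bigr do rewrite -formE.
    by apply: ltW; move: hlt; rewrite (_ : 2 * _ = rho * h%:R)//; field.
  - by move=> p; rewrite /x/= -{1}Hsym mxE.
  - rewrite /x; under eq_bigr do rewrite exprMn exprVn.
    by rewrite -mulr_suml -sqr_frob divff// expf_neq0.
  - rewrite alN /x; under eq_bigr do rewrite normrM normfV (gtr0_norm f0).
    by rewrite -mulr_suml -mnorm1E ler_pdivrMr.
rewrite -ler_pdivlMr//; apply: (le_trans key); rewrite mulr_suml.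
apply: ler_sum => i _; rewrite pair_formE.
have -> : (frob H)^-1 = `|(frob H)^-1| by rewrite gtr0_norm// invr_gt0.
rewrite -normrM mulr_suml.
by under eq_bigr do rewrite /x mulrA.
Qed.

End sampling_event.

Lemma subgaussian_exp_sqr (R : realType) (mu : probability R R) : subgaussian mu ->
  exists th G : R, 0 < th /\ (\int[mu]_x (expR (th * x ^+ 2))%:E = G%:E)%E.
Proof.
move=> [K [K0 tail]].
exists (4 * K ^+ 2)^-1, (fine (\int[mu]_x (expR ((4 * K ^+ 2)^-1 * x ^+ 2))%:E)%E).
split; first by rewrite invr_gt0 mulr_gt0// exprn_gt0.
have h := @ge0_integral_exp_sqr_le _ R R mu id K K0 (@measurable_id _ _ setT) tail.
rewrite fineK// ge0_fin_numE; last by apply: integral_ge0 => x _; rewrite lee_fin expR_ge0.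
exact: le_lt_trans h (ltry _).
Qed.

(** [card_grid_ball] is used at [x = k / n^2 = exp(-L)]: the factor [x^-N] gives [16 l^2 k L], and
    [4 x n^2 = 4 k] is at most [8 k L] because [L >= ln 2 >= 1 / 2]. *)
Lemma net_card_le (R : realType) (n k l : nat) : (0 < k)%N -> (2 * k <= n ^ 2)%N ->
  #|[set t : {ffun 'I_n * 'I_n -> grid (16 * k * l ^ 2)} |
      (\sum_p gmag (t p) <= 16 * k * l ^ 2)%N]%SET|%:R <=
  expR ((16 * l%:R ^+ 2 + 8) * (k%:R * ln ((n ^ 2)%:R / k%:R))) :> R.
Proof.
move=> k0 kn; set L := ln _.
have kR0 : 0 < k%:R :> R by rewrite ltr0n.
have nR0 : 0 < (n ^ 2)%:R :> R.
  by rewrite ltr0n (leq_trans _ kn)// muln_gt0.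
have knR : 2 * k%:R <= (n ^ 2)%:R :> R by rewrite -natrM ler_nat.
have q2 : 2 <= (n ^ 2)%:R / k%:R :> R by rewrite ler_pdivlMr.
have L2 : 1 / 2 <= L.
  by apply: (le_trans (ln2_ge_half R)); rewrite ler_ln ?posrE ?divr_gt0.
have eL : expR (- L) = k%:R / (n ^ 2)%:R.
  by rewrite expRN lnK ?posrE ?divr_gt0// invf_div.
have hx : 0 < expR (- L) <= 1 / 2.
  by rewrite expR_gt0 eL/= ler_pdivrMr//; lra.
apply: (le_trans (card_grid_ball _ _ hx)).
rewrite -expRM_natr -expRN -expRD ler_expR eL card_prod card_ord.
have -> : 4 * (k%:R / (n ^ 2)%:R) * (n * n)%:R = 4 * k%:R :> R.
  by rewrite mulnn -mulrA divfK// gt_eqF.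
rewrite 2!natrM natrX mulNr opprK.
by have := ler_wpM2l (ltW kR0) L2; lra.
Qed.

(** * Choice of the constants and assembly of the recovery bound *)

Theorem theorem3 (R : realType) (mu : probability R R) :
  subgaussian mu ->
  (\int[mu]_x (x%:E) = 0)%E ->
  (\int[mu]_x ((x ^+ 2)%:E) = 1)%E ->
  (1 < \int[mu]_x ((x ^+ 4)%:E))%E ->
  exists c0 c1 C0 C1 C2 : R,
    [/\ 0 < c0, 0 < c1, 0 < C0, 0 < C1 & 0 < C2] /\
    forall (n k m : nat),
      (1 <= k)%N -> (2 * k <= n ^ 2)%N ->
      c1 * k%:R * ln ((n ^ 2)%:R / k%:R) < m%:R ->
      forall (d : measure_display) (T : measurableType d) (P : probability T R)
             (Z : 'I_m * 'I_n -> T -> R),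
        (forall p, has_law P (Z p) mu) ->
        mutually_independent P Z ->
        exists E : set T,
          [/\ measurable E,
              ((1 - C0 * expR (- (c0 * m%:R)))%:E <= P E)%E &
              forall w, E w ->
                let a : 'I_m -> 'cV[R]_n := fun i => \col_j Z (i, j) w in
                forall (Sig : 'M[R]_n), psd Sig ->
                forall (eps1 : R), 0 <= eps1 ->
                forall (eta : 'cV[R]_m), vnorm1 eta <= eps1 ->
                forall (Sighat : 'M[R]_n),
                  is_minimizer a (Aop a Sig + eta) eps1 Sighat ->
                forall S : {set 'I_n * 'I_n}, is_topk k Sig S ->
                  frob (Sighat - Sig) <=
                    C1 * mnorm1 (Sig - restrict_mx S Sig) / Num.sqrt k%:R
                    + C2 * eps1 / m%:R].
Proof.
move=> sub mean0 var1 kurt.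
have [th [G [th0 expG]]] := subgaussian_exp_sqr sub.
have kurt1 : 1 < m4 mu.
  rewrite -lte_fin fineK//.
  exact: (integrable_fin_num measurableT (integrable_pow th0 expG (leqnn 4))).
pose r := chaos_radius th G; pose K := chaos_const th G.
pose rho := small_ball_const mu th G.
have r0 : 0 < r := chaos_radius_gt0 th0 expG.
have rho0 : 0 < rho := small_ball_const_gt0 th0 expG kurt1.
(* One successor exceeds the quotient; the second ensures [2 <= l]. *)
pose l := (Num.truncn ((K + 3) / (r * (rho / 2)))).+2.
have lbig : K + 3 <= r * l%:R * (rho / 2).
  rewrite mulrAC -ler_pdivrMl; last by rewrite mulr_gt0// divr_gt0.
  rewrite mulrC; apply/ltW/(lt_le_trans (truncnS_gt _)).
  by rewrite ler_nat.
have [om [om0 om1 om2]] : exists om : R, [/\ 0 < om, om <= 1 & om <= rho / 2].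
  exists (Num.min 1 (rho / 2)).
  split; first by rewrite lt_min ltr01 divr_gt0.
    by rewrite ge_min lexx.
  by rewrite ge_min lexx orbT.
have [A AE] : exists A : R, A = 3 * (16 * l%:R ^+ 2 + 8) by eexists.
have A0 : 0 <= A by rewrite AE mulr_ge0// addr_ge0// mulr_ge0// sqr_ge0.
(* The factor 3 in [A] and in [c0] comes from [m <= 3 h]. In [c1], [A / om] pays for the net and
   [+ 2] forces [m >= 2]; [C0 = 2] counts the bad events; [12 / rho] combines
   [rho / 2 * h * |H|_F <= 2 eps] with [m <= 3 h]. *)
exists (om / 3), (A / om + 2), 2, 1, (12 / rho); split.
  have Aom : 0 <= A / om by rewrite divr_ge0// ltW.
  by split=> //; [exact: divr_gt0|lra|exact: divr_gt0].
move=> n k m k0 kn cm.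
case: n kn cm => [|n] kn cm; first by case: k k0 kn {cm}.
set L := ln _ in cm.
have kR1 : 1 <= k%:R :> R by rewrite ler1n.
have L2 : 1 / 2 <= L.
  apply: (le_trans (ln2_ge_half R)); rewrite ler_ln ?posrE//; last first.
    by rewrite divr_gt0 ?ltr0n// (leq_trans _ kn)// muln_gt0.
  by rewrite ler_pdivlMr ?ltr0n// -natrM ler_nat.
have kL : 1 / 2 <= k%:R * L.
  have h0 : 0 <= 1 / 2 :> R by lra.
  by have := ler_pM ler01 h0 kR1 L2; rewrite mul1r.
have Aom0 : 0 <= A / om by rewrite divr_ge0// ltW.
have m2 : (2 <= m)%N.
  rewrite -(ltr_nat R); apply: le_lt_trans cm; rewrite -mulrA mulrDl.
  have h0 : 0 <= k%:R * L by apply: le_trans kL; lra.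
  by have := mulr_ge0 Aom0 h0; lra.
case: m cm m2 => // m cm m2.
pose h := m.+1./2.
have mE : (m.+1 = odd m.+1 + (h + h))%N by rewrite addnn odd_double_half.
have hm : (h + h <= m.+1)%N by rewrite [leqRHS]mE leq_addl.
have m3h : (m.+1 <= 3 * h)%N.
  have h1 : (0 < h)%N by rewrite half_gt0.
  rewrite [leqLHS]mE (_ : 3 * h = h + (h + h))%N; last by rewrite !mulSn mul0n addn0.
  by rewrite leq_add2r; case: odd.
have m3hR : m.+1%:R <= 3 * h%:R :> R by rewrite -natrM ler_nat.
have kLm : A / om * (k%:R * L) <= m.+1%:R.
  apply: ltW; apply: le_lt_trans cm; rewrite -[leRHS]mulrA [leRHS]mulrDl lerDl mulr_ge0//.
  by apply: le_trans kL; lra.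
have netc : (16 * l%:R ^+ 2 + 8) * (k%:R * L) <= om * h%:R.
  move: kLm; rewrite mulrAC ler_pdivrMr// => kLm.
  have := ler_wpM2l (ltW om0) m3hR; rewrite AE in kLm; lra.
move=> d T P Z lawZ indZ.
have netc' : #|[set t : {ffun 'I_n.+1 * 'I_n.+1 -> grid (16 * k * l ^ 2)} |
    (\sum_p gmag (t p) <= 16 * k * l ^ 2)%N]%SET|%:R <= expR (om * h%:R).
  by apply: (le_trans (net_card_le R l k0 kn)); rewrite ler_expR.
have [E [mEv PE HE]] := @sampling_event R mu th G th0 expG mean0 var1 kurt1 l om
  isT lbig om1 om2 m n k h k0 hm netc' d T P Z lawZ indZ.
exists E; split=> //.
  apply: le_trans PE; rewrite lee_fin lerD2l lerN2 ler_wpM2l// ler_expR lerN2.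
  by have := ler_wpM2l (ltW om0) m3hR; lra.
move=> w Ew a Sig psdS eps eps0 eta etae Sighat hmin S [Sk _].
have [psdH _ minH] := hmin.
have le1 : mnorm1 Sighat <= mnorm1 Sig.
  by apply: minH => //; rewrite addrAC subrr add0r.
have cone := minimizer_cone Sk le1.
have resid := minimizer_residual etae hmin.
move: cone resid; set H := Sighat - Sig; set sig := mnorm1 (Sig - _) => cone resid.
have Hsym : H^T = H by rewrite /H linearB/= psdH.1 psdS.1.
have sk0 : 0 < Num.sqrt k%:R :> R by rewrite sqrtr_gt0 ltr0n.
have sig0 : 0 <= sig by rewrite /sig mnorm1E sumr_ge0.
have mR0 : 0 < m.+1%:R :> R by rewrite ltr0n.
have T1 : 0 <= 1 * sig / Num.sqrt k%:R by rewrite mul1r divr_ge0// ltW.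
have T2 : 0 <= 12 / rho * eps / m.+1%:R.
  by rewrite divr_ge0 ?ler0n// mulr_ge0// divr_ge0// ltW.
(* Either the approximation error already dominates, or [sig < sqrt k * frob H] and the cone
   inequality becomes [mnorm1 H <= 4 * sqrt k * frob H]. *)
have [small|big] := leP (frob H) (1 * sig / Num.sqrt k%:R).
  by apply: (le_trans small); rewrite lerDl.
suff : frob H <= 12 / rho * eps / m.+1%:R.
  by move=> /le_trans; apply; rewrite lerDr.
have Hcone : mnorm1 H <= 4 * Num.sqrt k%:R * frob H.
  by move: big; rewrite mul1r ltr_pdivrMr// => big; lra.
have low := HE w Ew H Hsym Hcone; rewrite -/rho in low.
have up := pair_form_le_Aop Z hm w H.
have f0 : 0 <= frob H by exact: sqrtr_ge0.
rewrite ler_pdivlMr// mulrAC ler_pdivlMr//.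
have := ler_wpM2r (mulr_ge0 (ltW rho0) f0) m3hR.
rewrite -/a in up; lra.
Qed.
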